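(* There exist a flat Riemannian metric $g$ on the open unit disk $\mathbb{D}\subset\mathbb{C}$ and two quasiconformal minimal diffeomorphisms $f_1,f_2:(\mathbb{D},g)\to(\mathbb{D},g)$ that extend continuously to the same homeomorphism of $\partial\mathbb{D}$, such that the Hopf differential of one of them is in $L^1$, while the Hopf differential of the other is not in $L^1$.
   Context: A diffeomorphism $f:(\mathbb{D},\sigma_1)\to(\mathbb{D},\sigma_2)$ between Riemannian disks is a minimal diffeomorphism if its graph $G=\{(z,f(z))\}$ in the Riemannian product $4$-manifold $(\mathbb{D}^2,\sigma_1\oplus\sigma_2)$ is a minimal surface. Give $G$ the complex structure of its induced metric and parametrize it conformally by the unit disk $\mathbb{D}$ with its standard complex structure. The two coordinate projections of $G$ become harmonic diffeomorphisms $h_i:\mathbb{D}\to(\mathbb{D},\sigma_i)$, $i=1,2$, with $f=h_2\circ h_1^{-1}$ and opposite Hopf differentials, where the Hopf differential of a harmonic map $h:\mathbb{D}\to(M,\sigma)$ is the holomorphic quadratic differential $\phi(h)=(h^*\sigma)\left(\frac{\partial}{\partial z},\frac{\partial}{\partial z}\right)dz^2$. The Hopf differential of the minimal diffeomorphism $f$ is $\phi(h_1)$ (defined up to pullback by biholomorphisms of $\mathbb{D}$). A quadratic differential $\phi(z)dz^2$ on $\mathbb{D}$ is in $L^1$ if $\int_{\mathbb{D}}|\phi(z)|\,dx\,dy<\infty$; this condition is invariant under biholomorphisms. Quasiconformal is meant in the usual sense for homeomorphisms of $\mathbb{D}\subset\mathbb{C}$. *)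

(* Defs.v *)
From HB Require Import structures.
From mathcomp Require Import all_boot all_order all_algebra.
From mathcomp Require Import all_classical all_reals all_analysis.
From mathcomp Require Import complex.

Set Implicit Arguments.
Unset Strict Implicit.
Unset Printing Implicit Defensive.
Import Order.TTheory GRing.Theory Num.Theory.
Import numFieldNormedType.Exports.
Local Open Scope classical_set_scope.
Local Open Scope ring_scope.
Local Open Scope complex_scope.

(* Maps and metrics are total functions on R^n; only their values on the set
   under consideration are constrained. *)

Section calculus.
Context {R : realType} {n : nat} {V : normedModType R}.
Implicit Types (U : set 'rV[R]_n) (F : 'rV[R]_n -> V) (i : 'I_n).

Definition partial i F : 'rV[R]_n -> V := 'D_(delta_mx 0 i) F.

Definition iter_partial (s : seq 'I_n) F : 'rV[R]_n -> V := foldr partial F s.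

(* On an open set [U], this is the C^oo class: differentiability of the
   partial derivatives of every order gives their continuity. *)
Definition smooth U F :=
  forall (s : seq 'I_n) p, U p -> differentiable (iter_partial s F) p.

End calculus.

Definition diffeomorphism {R : realType} {n : nat} (U V : set 'rV[R]_n)
    (f : 'rV[R]_n -> 'rV[R]_n) :=
  smooth U f /\
  exists g : 'rV[R]_n -> 'rV[R]_n,
    [/\ smooth V g, f @` U `<=` V, g @` V `<=` U,
        forall p, U p -> g (f p) = p & forall q, V q -> f (g q) = q].

Definition homeomorphism {R : realType} {n : nat} (A B : set 'rV[R]_n)
    (f : 'rV[R]_n -> 'rV[R]_n) :=
  {within A, continuous f} /\
  exists g : 'rV[R]_n -> 'rV[R]_n,
    [/\ {within B, continuous g}, f @` A `<=` B, g @` B `<=` A,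
        forall p, A p -> g (f p) = p & forall q, B q -> f (g q) = q].

Section riemannian.
Context {R : realType} {n : nat}.
Implicit Types (U : set 'rV[R]_n) (g : 'rV[R]_n -> 'M[R]_n).

Definition inner g (p v w : 'rV[R]_n) : R := (v *m g p *m w^T) 0 0.

Definition riemannian_metric U g :=
  [/\ smooth U g, forall p, U p -> (g p)^T = g p &
      forall p v, U p -> v != 0 -> 0 < inner g p v v].

(* Gamma^k_{ij} *)
Definition christoffel g (p : 'rV[R]_n) (k i j : 'I_n) : R :=
  2^-1 * \sum_l invmx (g p) k l *
    (partial i g p j l + partial j g p i l - partial l g p i j).

(* The component R^l_{kij} of the curvature tensor, i.e.
   R(d_i, d_j) d_k = \sum_l R^l_{kij} d_l. *)
Definition curvature g (p : 'rV[R]_n) (l k i j : 'I_n) : R :=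
  partial i (fun q => christoffel g q l j k : R^o) p -
  partial j (fun q => christoffel g q l i k : R^o) p +
  \sum_m (christoffel g p l i m * christoffel g p m j k -
          christoffel g p l j m * christoffel g p m i k).

Definition flat U g := forall p l k i j, U p -> curvature g p l k i j = 0.

End riemannian.

Section submanifolds.
Context {R : realType} {m n : nat}.
Implicit Types (F : 'rV[R]_m -> 'rV[R]_n) (g : 'rV[R]_n -> 'M[R]_n).

(* The i-th row of ['J F p] is the tangent vector F_*(d_i). *)
Definition pullback F g (p : 'rV[R]_m) : 'M[R]_m :=
  'J F p *m g (F p) *m ('J F p)^T.

(* The covariant derivative of F_*(d_j) along F_*(d_i), for the Levi-Civita
   connection of g. *)
Definition covariant2 g F (p : 'rV[R]_m) (i j : 'I_m) : 'rV[R]_n :=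
  partial i (partial j F) p +
  \row_a \sum_b \sum_c christoffel g (F p) a b c * 'J F p i b * 'J F p j c.

(* The trace, for the induced metric, of the second fundamental form in the
   direction N; for N normal to the image of F, this is the inner product of N
   with the (unnormalized) mean curvature vector. *)
Definition mean_curvature g F (p : 'rV[R]_m) (N : 'rV[R]_n) : R :=
  \sum_i \sum_j
    invmx (pullback F g p) i j * inner g (F p) (covariant2 g F p i j) N.

Definition minimal_immersion (U : set 'rV[R]_m) g F :=
  forall p N, U p ->
    (forall i, inner g (F p) (row i ('J F p)) N = 0) ->
    mean_curvature g F p N = 0.

End submanifolds.

Definition product_metric {R : realType} {m n : nat}
    (sigma1 : 'rV[R]_m -> 'M[R]_m) (sigma2 : 'rV[R]_n -> 'M[R]_n)
    (q : 'rV[R]_(m + n)) : 'M[R]_(m + n) :=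
  block_mx (sigma1 (lsubmx q)) 0 0 (sigma2 (rsubmx q)).

Section disk.
Context {R : realType}.
Implicit Types (f h : 'rV[R]_2 -> 'rV[R]_2) (sigma : 'rV[R]_2 -> 'M[R]_2).

(* The complex number x + iy is represented by the row vector xy x y. *)
Definition xy (x y : R) : 'rV[R]_2 := \row_i (if i == 0 then x else y).

Definition disk : set 'rV[R]_2 := [set p | p 0 0 ^+ 2 + p 0 1 ^+ 2 < 1].
Definition circle : set 'rV[R]_2 := [set p | p 0 0 ^+ 2 + p 0 1 ^+ 2 = 1].
Definition closed_disk : set 'rV[R]_2 :=
  [set p | p 0 0 ^+ 2 + p 0 1 ^+ 2 <= 1].

Definition complex_of (p : 'rV[R]_2) : R[i] := p 0 0 +i* p 0 1.

Definition area := (@lebesgue_measure R \x @lebesgue_measure R)%E.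

Definition extends_to f (psi : 'rV[R]_2 -> 'rV[R]_2) :=
  exists F : 'rV[R]_2 -> 'rV[R]_2,
    [/\ {within closed_disk, continuous F},
        forall p, disk p -> F p = f p & forall p, circle p -> F p = psi p].

Definition dz f (p : 'rV[R]_2) : R[i] :=
  (complex_of (partial 0 f p) - 'i * complex_of (partial 1 f p)) / 2%:R.

Definition dzbar f (p : 'rV[R]_2) : R[i] :=
  (complex_of (partial 0 f p) + 'i * complex_of (partial 1 f p)) / 2%:R.

(* A finite family of nonoverlapping intervals is listed from left to right. *)
Definition absolutely_continuous (a b : R) (c : R -> 'rV[R]_2) :=
  forall e : R, 0 < e -> exists2 d : R, 0 < d &
    forall s : seq (R * R),
      all (fun I => [&& a <= I.1, I.1 <= I.2 & I.2 <= b]) s ->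
      pairwise (fun I J => I.2 <= J.1) s ->
      \sum_(I <- s) (I.2 - I.1) < d ->
      \sum_(I <- s) `|c I.2 - c I.1| < e.

Definition absolutely_continuous_on_lines (U : set 'rV[R]_2) f :=
  forall a b c d : R, a < b -> c < d ->
    (forall x y, a <= x <= b -> c <= y <= d -> U (xy x y)) ->
    {ae lebesgue_measure, forall y, c <= y <= d ->
      absolutely_continuous a b (fun x => f (xy x y))} /\
    {ae lebesgue_measure, forall x, a <= x <= b ->
      absolutely_continuous c d (fun y => f (xy x y))}.

(* The analytic definition. Absolute continuity on lines makes the partial
   derivatives exist almost everywhere; the dilatation bound with k < 1 forces
   f to preserve the orientation. *)
Definition quasiconformal (U V : set 'rV[R]_2) f :=
  [/\ homeomorphism U V f, absolutely_continuous_on_lines U f &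
      exists k : R, 0 <= k < 1 /\
        {ae area, forall z, U (xy z.1 z.2) ->
          Normc.normc (dzbar f (xy z.1 z.2)) <= k * Normc.normc (dz f (xy z.1 z.2))}].

Definition minimal_diffeomorphism sigma1 sigma2 f :=
  diffeomorphism disk disk f /\
  minimal_immersion disk (product_metric sigma1 sigma2)
    (fun p => row_mx p (f p)).

(* (h^* sigma)(d/dz, d/dz), where d/dz = (d/dx - i d/dy) / 2 and h^* sigma is
   extended complex bilinearly; the differential is hopf h sigma dz^2. *)
Definition hopf h sigma (p : 'rV[R]_2) : R[i] :=
  let ddz : 'rV[R[i]]_2 := \row_i (if i == 0 then 1 / 2%:R else - 'i / 2%:R) in
  (ddz *m map_mx (fun x : R => x%:C) (pullback h sigma p) *m ddz^T) 0 0.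

(* (h1, h2) is a conformal, orientation preserving parametrization by the disk
   of the graph of f, with its metric induced by sigma1 (+) sigma2 and
   oriented by its first projection. *)
Definition conformal_parametrization sigma1 sigma2 f h1 h2 :=
  [/\ diffeomorphism disk disk h1,
      forall p, disk p -> h2 p = f (h1 p),
      forall p, disk p -> 0 < \det ('J h1 p) &
      forall p, disk p -> exists2 lambda : R, 0 < lambda &
        pullback (fun q => row_mx (h1 q) (h2 q))
          (product_metric sigma1 sigma2) p = lambda%:M].

(* phi dz^2 represents the Hopf differential of the minimal diffeomorphism f,
   which is defined up to pullback by biholomorphisms of the disk. *)
Definition hopf_differential sigma1 sigma2 f (phi : 'rV[R]_2 -> R[i]) :=
  exists h1 h2, conformal_parametrization sigma1 sigma2 f h1 h2 /\
    forall p, disk p -> phi p = hopf h1 sigma1 p.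

Definition in_L1 (phi : 'rV[R]_2 -> R[i]) :=
  (\int[area]_(z in [set z : R * R | disk (xy z.1 z.2)])
     (Normc.normc (phi (xy z.1 z.2)))%:E < +oo)%E.

End disk.

(* Main.v *)
From HB Require Import structures.
Require Import Defs.
From mathcomp Require Import all_boot all_order all_algebra.
From mathcomp Require Import all_classical all_reals all_analysis.
From mathcomp Require Import complex.
From mathcomp Require Import ring lra.

(* The map c(z) = (1 + z) / (1 - z) identifies the disk with the right half plane
   {X > 0}; let g be the pullback of the Euclidean metric.  The linear maps
   (X, Y) |-> (lambda X, Y) preserve the half plane and fix its boundary
   pointwise.  Read on the disk, they are quasiconformal with constant dilatation,
   extend by the identity to the circle, and their graphs are totally geodesic.
   For lambda = 1 every parametrization of the graph has zero Hopf differential.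
   For lambda = 7 the graph is the half plane with metric 50 dX^2 + 2 dY^2, for
   which (5 X, Y) is conformal; the Hopf differential is a nonzero constant in this
   chart, so its L^1 norm in any parametrization by the disk is proportional to
   the area of the half plane. *)

Set Implicit Arguments.
Unset Strict Implicit.
Unset Printing Implicit Defensive.
Import Order.TTheory GRing.Theory Num.Theory.
Import numFieldNormedType.Exports.
Local Open Scope classical_set_scope.
Local Open Scope ring_scope.

(** * Gradients and smooth functions *)

Section calculus.
Context {R : realType}.

(** The integrability claims range over all conformal parametrizations [h1] of the graph, and no
    uniqueness of these is established. Instead, conformality alone gives quadratic relations
    between the gradients of the two coordinates of c o h1. For lambda = 1 they are exactly the
    vanishing of the Hopf differential. For lambda = 7 they give |phi| = (6 / 25) mu, where mu is
    the conformal factor of (5 X, Y) o c o h1, whatever [h1] is. The infinite integral of mu is then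
    bounded below by simple functions supported in preimages of small squares of the half plane.

    The value 7 makes (1 + lambda^2) / 2 = 25 a perfect square, so the conformal chart has rational
    coefficients. More generally c and all maps of the disk built here are rational in the real
    coordinates, so curvature, minimality and dilatation reduce to polynomial identities in c', c''
    / c' and the Jacobian entries. *)

Lemma near_eq_differentiable (V W : normedModType R) (f g : V -> W) a :
  {near a, f =1 g} -> differentiable f a -> differentiable g a.
Proof.
move=> fg df.
(* The difference [g - f] vanishes near [a], so its differential there is zero. *)
suff dh : differentiable (g - f) a by rewrite -[g](subrK f); exact: differentiableD.
have ho : (g - f) \o shift a = cst ((g - f) a) + (\0 : V -> W) +o_ 0 id.
  apply/eqaddoP => _/posnumP[e].
  have : \forall y \near 0, f (y + a) = g (y + a).
    by move: (fg); rewrite {1}(near_shift 0) subr0.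
  apply: filterS => y fgy.
  rewrite !fctE /= !(nbhs_singleton fg) -fgy !subrr addr0 subrr normr0.
  by rewrite mulr_ge0.
have h0 : 'd (g - f) a = (\0 : V -> W) :> (V -> W).
  by apply: diff_unique ho => x; exact: cvg_cst.
by apply/diff_locallyP; rewrite h0; split => // x; exact: cvg_cst.
Unshelve. all: by end_near. Qed.

Section scalar.
Context {n : nat}.
Implicit Types (f g : 'rV[R]_n -> R^o) (p : 'rV[R]_n) (d e : 'I_n -> R).

(** Partial derivatives alone do not satisfy the chain rule. Carrying differentiability along lets
    the gradient of a rational expression be assembled from the rules below. *)
Definition has_gradient f p d :=
  differentiable f p /\ forall i, partial i f p = d i.

Lemma has_gradientW f p : differentiable f p ->
  has_gradient f p (fun i => partial i f p).
Proof. by []. Qed.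

Lemma has_gradient_eq f p d e : has_gradient f p d -> d =1 e ->
  has_gradient f p e.
Proof. by move=> [df fd] de; split => // i; rewrite fd. Qed.

Lemma near_eq_has_gradient f g p d : {near p, f =1 g} ->
  has_gradient f p d -> has_gradient g p d.
Proof.
move=> fg [df fd]; split; first exact: near_eq_differentiable fg df.
by move=> i; rewrite -fd /partial; apply/esym/near_eq_derive.
Qed.

Lemma has_gradient_derive f p d v : has_gradient f p d ->
  'D_v f p = \sum_i v 0 i * d i.
Proof.
move=> [df fd]; rewrite deriveE// [X in 'd f p X](row_sum_delta v) linear_sum.
by apply: eq_bigr => i _; rewrite linearZ /= -deriveE// -fd.
Qed.

Lemma has_gradient_cst (c : R) p : has_gradient (fun=> c) p (fun=> 0).
Proof.
split; first exact: differentiable_cst.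
by move=> i; rewrite /partial (derive_cst (c : R^o)).
Qed.

Lemma has_gradient_coord k p :
  has_gradient (fun q => q 0 k) p (fun i => (i == k)%:R).
Proof.
split; first exact: differentiable_coord.
move=> i; rewrite /partial deriveE; last exact: differentiable_coord.
have c : continuous (fun q : 'rV[R]_n => q 0 k : R^o) by exact: coord_continuous.
have l : linear (fun q : 'rV[R]_n => q 0 k : R^o) by move=> a u v; rewrite !mxE.
pose H := GRing.isLinear.Build _ _ _ _ (fun q : 'rV[R]_n => q 0 k : R^o) l.
pose L : {linear 'rV[R]_n -> R^o} := HB.pack (fun q : 'rV[R]_n => q 0 k : R^o) H.
by rewrite (@diff_lin _ _ _ L)//= mxE eqxx /= eq_sym.
Qed.

Lemma has_gradientD f g p d e : has_gradient f p d -> has_gradient g p e ->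
  has_gradient (fun q => f q + g q) p (fun i => d i + e i).
Proof.
move=> [df fd] [dg ge]; split; first exact: differentiableD.
move=> i; rewrite /partial deriveD; try exact: diff_derivable.
by congr (_ + _); [exact: fd | exact: ge].
Qed.

Lemma has_gradientN f p d : has_gradient f p d ->
  has_gradient (fun q => - f q) p (fun i => - d i).
Proof.
move=> [df fd]; split; first exact: differentiableN.
by move=> i; rewrite /partial deriveN//; [congr (- _); exact: fd|exact: diff_derivable].
Qed.

Lemma has_gradientB f g p d e : has_gradient f p d -> has_gradient g p e ->
  has_gradient (fun q => f q - g q) p (fun i => d i - e i).
Proof. by move=> fd ge; apply: has_gradientD => //; exact: has_gradientN. Qed.

Lemma has_gradientM f g p d e : has_gradient f p d -> has_gradient g p e ->
  has_gradient (fun q => f q * g q) p (fun i => d i * g p + f p * e i).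
Proof.
move=> [df fd] [dg ge]; split; first exact: differentiableM.
move=> i; rewrite /partial deriveM; try exact: diff_derivable.
rewrite addrC /GRing.scale/= [g p * _]mulrC.
by congr (_ * _ + _ * _); [exact: fd | exact: ge].
Qed.

Lemma has_gradientV f p d : has_gradient f p d -> f p != 0 ->
  has_gradient (fun q => (f q)^-1) p (fun i => - (f p) ^- 2 * d i).
Proof.
move=> [df fd] f0; split; first exact: differentiableV.
by move=> i; rewrite /partial deriveV//; [congr (_ *: _); exact: fd|exact: diff_derivable].
Qed.

End scalar.

Lemma differentiable_mxP (V : normedModType R) m n (F : V -> 'M[R]_(m, n)) p :
  differentiable F p <->
  forall i j, differentiable (fun q => F q i j : R^o) p.
Proof.
split=> [dF i j|dF].
  by apply: (differentiable_comp (g := fun M : 'M[R]_(m, n) => M i j : R^o)) => //;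
    exact: differentiable_coord.
rewrite (_ : F = \sum_i \sum_j (fun q => (F q i j : R^o) *: delta_mx i j)).
  by apply: differentiable_sum => i; apply: differentiable_sum => j;
    exact: differentiableZl.
apply/funext => q; rewrite fct_sumE [LHS]matrix_sum_delta.
by apply: eq_bigr => i _; rewrite fct_sumE.
Qed.

Lemma partial_mx k m n (F : 'rV[R]_k -> 'M[R]_(m, n)) l p i j :
  differentiable F p ->
  partial l F p i j = partial l (fun q => F q i j : R^o) p.
Proof.
by move=> dF; rewrite /partial derive_mx ?mxE//; exact: diff_derivable.
Qed.

Lemma jacobian_partial m n (F : 'rV[R]_m -> 'rV[R]_n) p i :
  differentiable F p -> row i ('J F p) = partial i F p.
Proof. by move=> dF; rewrite /partial deriveEjacobian// rowE. Qed.

Lemma has_gradient_row m n (F : 'rV[R]_m -> 'rV[R]_n) p (d : 'I_n -> 'I_m -> R) :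
  (forall k, has_gradient (fun q => F q 0 k) p (d k)) ->
  [/\ differentiable F p, forall i k, partial i F p 0 k = d k i
    & 'J F p = \matrix_(i, k) d k i].
Proof.
move=> Fd; have dF : differentiable F p.
  by apply/differentiable_mxP => i k; rewrite ord1; have [] := Fd k.
have pF i k : partial i F p 0 k = d k i.
  by rewrite partial_mx//; have [_ ->] := Fd k.
by split=> //; apply/matrixP => i k; rewrite [RHS]mxE -pF -jacobian_partial// [RHS]mxE.
Qed.

Lemma has_gradient_of_row m n (F : 'rV[R]_m -> 'rV[R]_n) p k :
  differentiable F p ->
  has_gradient (fun q => F q 0 k) p (fun i => 'J F p i k).
Proof.
move=> dF; split; first by move/differentiable_mxP : dF; exact.
by move=> i; rewrite -partial_mx// -jacobian_partial// mxE.
Qed.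

Lemma has_gradient_comp m n (f : 'rV[R]_n -> R^o) (F : 'rV[R]_m -> 'rV[R]_n) p
    (d : 'I_n -> R) (e : 'I_n -> 'I_m -> R) :
  has_gradient f (F p) d -> (forall k, has_gradient (fun q => F q 0 k) p (e k)) ->
  has_gradient (fun q => f (F q)) p (fun i => \sum_k e k i * d k).
Proof.
move=> fd Fe; have [dF pF _] := has_gradient_row Fe; have [df _] := fd.
split; first exact: (differentiable_comp dF df).
move=> i; rewrite /partial deriveE; last exact: (differentiable_comp dF df).
rewrite (diff_comp dF df) /= -[X in 'd f _ X]deriveE// -deriveE//.
by rewrite (has_gradient_derive _ fd); apply: eq_bigr => k _; rewrite -pF.
Qed.

Section smooth_functions.
Context {n : nat} (U : set 'rV[R]_n) (openU : open U).
Implicit Types V W : normedModType R.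

(** Grading by the order allows induction: the derivative of a product or an inverse contains the
    functions themselves, which are still available at the lower order. *)
Definition smooth_upto V k (F : 'rV[R]_n -> V) :=
  forall (s : seq 'I_n), (size s <= k)%N ->
  forall p, U p -> differentiable (iter_partial s F) p.

Lemma smooth_uptoP V (F : 'rV[R]_n -> V) :
  smooth U F <-> forall k, smooth_upto k F.
Proof. by split=> [sF k s _ p|sF s p]; [exact: sF | exact: sF]. Qed.

Lemma smooth_upto_le V k l (F : 'rV[R]_n -> V) : (k <= l)%N ->
  smooth_upto l F -> smooth_upto k F.
Proof. by move=> kl sF s sk; apply: sF; exact: leq_trans kl. Qed.

(** The derivative split off is the innermost one, applied to [F] first, since the calculus rules
    rewrite that one. *)
Lemma smooth_uptoS V k (F : 'rV[R]_n -> V) : smooth_upto k.+1 F <->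
  (forall p, U p -> differentiable F p) /\ forall i, smooth_upto k (partial i F).
Proof.
split=> [sF|[dF sF]].
  split=> [|i s sk]; first exact: (sF [::]).
  by have := sF (rcons s i); rewrite size_rcons /iter_partial foldr_rcons; exact.
move=> s; case: (lastP s) => [_|{}s i]; first exact: dF.
by rewrite size_rcons /iter_partial foldr_rcons; exact: sF.
Qed.

Lemma smooth_upto0 V (F : 'rV[R]_n -> V) : smooth_upto 0 F <->
  forall p, U p -> differentiable F p.
Proof.
by split=> [sF|dF]; [exact: (sF [::]) | move=> [|//] _; exact: dF].
Qed.

Lemma eq_near_on T (f g : 'rV[R]_n -> T) p : (forall q, U q -> f q = g q) -> U p ->
  {near p, f =1 g}.
Proof. by move=> fg Up; apply: filterS (open_nbhs_nbhs (conj openU Up)). Qed.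

(** Openness of [U] turns equality on [U] into equality near each point, which passes to derivatives
    of every order. Formulas for derivatives are available only on [U]. *)
Lemma smooth_upto_eq V k (F G : 'rV[R]_n -> V) :
  (forall p, U p -> F p = G p) -> smooth_upto k F -> smooth_upto k G.
Proof.
elim: k F G => [|k IH] F G FG.
  move=> /smooth_upto0 dF; apply/smooth_upto0 => p Up.
  exact: near_eq_differentiable (eq_near_on FG Up) (dF _ Up).
move=> /smooth_uptoS[dF sF]; apply/smooth_uptoS; split => [p Up|i].
  exact: near_eq_differentiable (eq_near_on FG Up) (dF _ Up).
by apply: IH (sF i) => p Up; exact/near_eq_derive/eq_near_on.
Qed.

Lemma smooth_upto_cst V k (c : V) : smooth_upto k (cst c).
Proof.
elim: k c => [|k IH] c; first by apply/smooth_upto0 => p _; exact: differentiable_cst.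
apply/smooth_uptoS; split => [p _|i]; first exact: differentiable_cst.
apply: smooth_upto_eq (IH 0) => p _.
by rewrite /partial (derive_cst c).
Qed.

Lemma smooth_uptoD V k (F G : 'rV[R]_n -> V) :
  smooth_upto k F -> smooth_upto k G -> smooth_upto k (fun p => F p + G p).
Proof.
elim: k F G => [|k IH] F G.
  move=> /smooth_upto0 dF /smooth_upto0 dG; apply/smooth_upto0 => p Up.
  exact: differentiableD (dF _ Up) (dG _ Up).
move=> /smooth_uptoS[dF sF] /smooth_uptoS[dG sG]; apply/smooth_uptoS; split=> [p Up|i].
  exact: differentiableD (dF _ Up) (dG _ Up).
apply: smooth_upto_eq (IH _ _ (sF i) (sG i)) => p Up.
by rewrite /partial deriveD//; apply: diff_derivable; [exact: dF | exact: dG].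
Qed.

Lemma smooth_uptoZl V k (f : 'rV[R]_n -> R^o) (v : V) :
  smooth_upto k f -> smooth_upto k (fun p => f p *: v).
Proof.
elim: k f => [|k IH] f.
  move=> /smooth_upto0 df; apply/smooth_upto0 => p Up.
  exact: differentiableZl (df _ Up).
move=> /smooth_uptoS[df sf]; apply/smooth_uptoS; split=> [p Up|i].
  exact: differentiableZl (df _ Up).
apply: smooth_upto_eq (IH _ (sf i)) => p Up.
have dfp := df _ Up.
rewrite /partial !deriveE//; last exact: differentiableZl.
by rewrite diffZl.
Qed.

Lemma smooth_upto_coord k i : smooth_upto k (fun p => p 0 i : R^o).
Proof.
have d p : differentiable (fun p : 'rV[R]_n => p 0 i : R^o) p.
  exact: differentiable_coord.
case: k => [|k]; first by apply/smooth_upto0.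
apply/smooth_uptoS; split => // j.
apply: smooth_upto_eq (smooth_upto_cst ((j == i)%:R : R^o)) => p _.
by have [_ ->] := has_gradient_coord i p.
Qed.

Lemma smooth_uptoM k (f g : 'rV[R]_n -> R^o) :
  smooth_upto k f -> smooth_upto k g -> smooth_upto k (fun p => f p * g p : R^o).
Proof.
elim: k f g => [|k IH] f g.
  move=> /smooth_upto0 dF /smooth_upto0 dG; apply/smooth_upto0 => p Up.
  exact: differentiableM (dF _ Up) (dG _ Up).
move=> sf sg; have sf0 := smooth_upto_le (leqnSn _) sf.
have sg0 := smooth_upto_le (leqnSn _) sg.
move: sf sg => /smooth_uptoS[df sf] /smooth_uptoS[dg sg]; apply/smooth_uptoS.
split=> [p Up|i]; first exact: differentiableM (df _ Up) (dg _ Up).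
have sfg := smooth_uptoD (IH _ _ (sf i) sg0) (IH _ _ sf0 (sg i)).
apply: smooth_upto_eq sfg => p Up.
have [_ /(_ i)<-//] := has_gradientM (has_gradientW (df _ Up)) (has_gradientW (dg _ Up)).
Qed.

Lemma smooth_uptoV k (f : 'rV[R]_n -> R^o) : (forall p, U p -> f p != 0) ->
  smooth_upto k f -> smooth_upto k (fun p => (f p)^-1 : R^o).
Proof.
move=> f0; elim: k => [|k IH].
  move=> /smooth_upto0 df; apply/smooth_upto0 => p Up.
  exact: differentiableV (df _ Up) (f0 _ Up).
move=> sf; have /IH sV := smooth_upto_le (leqnSn _) sf.
move: sf => /smooth_uptoS[df sf]; apply/smooth_uptoS.
split=> [p Up|i]; first exact: differentiableV (df _ Up) (f0 _ Up).
(* The derivative of 1 / f is - (1 / f)^2 f', where 1 / f is already known to be smooth up to order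
   [k]. *)
apply: smooth_upto_eq (smooth_uptoM (smooth_uptoM (smooth_upto_cst (-1 : R^o))
   (smooth_uptoM sV sV)) (sf i)) => p Up.
have [_ ->] := has_gradientV (has_gradientW (df _ Up)) (f0 _ Up).
by rewrite mulN1r -invfM.
Qed.

End smooth_functions.
End calculus.
(** * The flat metric *)

Section cayley.
Context {R : realType}.
Implicit Types (p q : 'rV[R]_2).

Lemma I2P (i : 'I_2) : {i = 0} + {i = 1}.
Proof. by case: i => [[|[|//]] i2]; [left|right]; apply/val_inj. Qed.

Definition pair2 (a b : R) (i : 'I_2) : R := if i == 0 then a else b.

Lemma has_gradient_pair (f : 'rV[R]_2 -> R^o) p d a b : has_gradient f p d ->
  d 0 = a -> d 1 = b -> has_gradient f p (pair2 a b).
Proof.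
by move=> fd da db; apply: has_gradient_eq fd _ => i; case: (I2P i) => ->.
Qed.

Lemma sum_I2 (F : 'I_2 -> R) : \sum_i F i = F 0 + F 1.
Proof. by rewrite big_ord_recl big_ord1; congr (_ + F _); apply/val_inj. Qed.

(** [den] is |1 - z|^2 and [defect] is 1 - |z|^2; their quotient is Re c. *)
Definition den p : R := (1 - p 0 0) * (1 - p 0 0) + p 0 1 * p 0 1.
Definition defect p : R := 1 - p 0 0 * p 0 0 - p 0 1 * p 0 1.

(* cay, dcay and lcay are the real and imaginary parts of c = (1 + z) / (1 - z),
   which maps the disk onto the right half plane, of its derivative c', and of
   l = 2 / (1 - z) = c'' / c'.  Note that c = l - 1 and c' = l' = l^2 / 2. *)
Definition cay1 p : R := defect p * (den p)^-1.
Definition cay2 p : R := 2 * p 0 1 * (den p)^-1.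
Definition dcay1 p : R :=
  2 * ((1 - p 0 0) * (1 - p 0 0) - p 0 1 * p 0 1) * ((den p)^-1 * (den p)^-1).
Definition dcay2 p : R := 4 * (1 - p 0 0) * p 0 1 * ((den p)^-1 * (den p)^-1).
Definition lcay1 p : R := 2 * (1 - p 0 0) * (den p)^-1.
Definition lcay2 p : R := 2 * p 0 1 * (den p)^-1.

(** |c'|^2, the conformal factor of the metric. *)
Definition rho p : R := dcay1 p * dcay1 p + dcay2 p * dcay2 p.

Lemma den_gradient p : has_gradient den p (pair2 (-2 * (1 - p 0 0)) (2 * p 0 1)).
Proof.
have G1x := has_gradientB (has_gradient_cst 1 p) (has_gradient_coord 0 p).
have Gy := has_gradient_coord 1 p.
apply: has_gradient_pair (has_gradientD (has_gradientM G1x G1x) (has_gradientM Gy Gy)) _ _.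
  by rewrite /=; ring.
by rewrite /=; ring.
Qed.

Lemma defect_gradient p : has_gradient defect p (pair2 (-2 * p 0 0) (-2 * p 0 1)).
Proof.
have Gx := has_gradient_coord 0 p.
have Gy := has_gradient_coord 1 p.
have G1 := has_gradientB (has_gradient_cst 1 p) (has_gradientM Gx Gx).
by apply: has_gradient_pair (has_gradientB G1 (has_gradientM Gy Gy)) _ _ => /=; ring.
Qed.

Lemma denV_gradient p : den p != 0 ->
  has_gradient (fun q => (den q)^-1) p
    (pair2 (lcay1 p * (den p)^-1) (- lcay2 p * (den p)^-1)).
Proof.
move=> D0; apply: has_gradient_pair (has_gradientV (den_gradient p) D0) _ _;
  by rewrite /pair2/= /lcay1 /lcay2; field.
Qed.

(** Cauchy-Riemann: if a holomorphic function has derivative a + i b, its real part has gradient (a,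
    - b) and its imaginary part (b, a). Here l' = c'. *)
Lemma lcay1_gradient p : den p != 0 ->
  has_gradient lcay1 p (pair2 (dcay1 p) (- dcay2 p)).
Proof.
move=> D0; have G1x := has_gradientB (has_gradient_cst 1 p) (has_gradient_coord 0 p).
have G := has_gradientM (has_gradientM (has_gradient_cst 2 p) G1x) (denV_gradient D0).
apply: has_gradient_pair G _ _; move: D0;
  by rewrite /pair2/= /dcay1 /dcay2 /lcay1 /lcay2 /den => D0; field.
Qed.

Lemma lcay2_gradient p : den p != 0 ->
  has_gradient lcay2 p (pair2 (dcay2 p) (dcay1 p)).
Proof.
move=> D0; have Gy := has_gradient_coord 1 p.
have G := has_gradientM (has_gradientM (has_gradient_cst 2 p) Gy) (denV_gradient D0).
apply: has_gradient_pair G _ _; move: D0;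
  by rewrite /pair2/= /dcay1 /dcay2 /lcay1 /lcay2 /den => D0; field.
Qed.

Lemma cay1E p : den p != 0 -> cay1 p = lcay1 p - 1.
Proof. by rewrite /cay1 /lcay1 /defect /den => D0; field. Qed.

Lemma cay1_gradient p : den p != 0 ->
  has_gradient cay1 p (pair2 (dcay1 p) (- dcay2 p)).
Proof.
move=> D0.
have G := has_gradientM (defect_gradient p) (denV_gradient D0).
apply: has_gradient_pair G _ _; move: D0;
  by rewrite /pair2/= /dcay1 /dcay2 /lcay1 /lcay2 /defect /den => D0; field.
Qed.

Lemma dcay1E p : dcay1 p = (lcay1 p * lcay1 p - lcay2 p * lcay2 p) / 2.
Proof. by rewrite /dcay1 /lcay1 /lcay2; move: (den p)^-1 => d; field. Qed.

Lemma dcay2E p : dcay2 p = lcay1 p * lcay2 p.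
Proof. by rewrite /dcay2 /lcay1 /lcay2; ring. Qed.

(** The Cauchy-Riemann equations for c'' = c' l, which follows from c' = l^2 / 2 and l' = c'. *)
Lemma dcay1_gradient p : den p != 0 ->
  has_gradient dcay1 p (pair2 (dcay1 p * lcay1 p - dcay2 p * lcay2 p)
                            (- (dcay1 p * lcay2 p + dcay2 p * lcay1 p))).
Proof.
move=> D0; have L1 := lcay1_gradient D0; have L2 := lcay2_gradient D0.
have G := has_gradientM (has_gradientB (has_gradientM L1 L1) (has_gradientM L2 L2))
            (has_gradient_cst 2^-1 p).
apply: (near_eq_has_gradient (f := fun q => (lcay1 q * lcay1 q - lcay2 q * lcay2 q) / 2)).
  by near=> q; rewrite -dcay1E.
by apply: has_gradient_pair G _ _; rewrite /pair2/=; field.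
Unshelve. all: by end_near. Qed.

Lemma dcay2_gradient p : den p != 0 ->
  has_gradient dcay2 p (pair2 (dcay1 p * lcay2 p + dcay2 p * lcay1 p)
                            (dcay1 p * lcay1 p - dcay2 p * lcay2 p)).
Proof.
move=> D0; have L1 := lcay1_gradient D0; have L2 := lcay2_gradient D0.
apply: (near_eq_has_gradient (f := fun q => lcay1 q * lcay2 q)).
  by near=> q; rewrite -dcay2E.
by apply: has_gradient_pair (has_gradientM L1 L2) _ _; rewrite /pair2/=; ring.
Unshelve. all: by end_near. Qed.

Lemma cay2_gradient p : den p != 0 ->
  has_gradient cay2 p (pair2 (dcay2 p) (dcay1 p)).
Proof. exact: lcay2_gradient. Qed.

(** The logarithmic derivative of |c'|^2 is governed by c'' / c' = l. *)
Lemma rho_gradient p : den p != 0 ->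
  has_gradient rho p (pair2 (2 * rho p * lcay1 p) (- 2 * rho p * lcay2 p)).
Proof.
move=> D0; have D1 := dcay1_gradient D0; have D2 := dcay2_gradient D0.
by apply: has_gradient_pair (has_gradientD (has_gradientM D1 D1) (has_gradientM D2 D2)) _ _;
  rewrite /pair2/= /rho; ring.
Qed.

Lemma rhoE p : den p != 0 -> rho p = 4 * (den p)^-1 ^+ 2.
Proof. by rewrite /rho /dcay1 /dcay2 /den => D0; field. Qed.

Lemma den_gt0 p : disk p -> 0 < den p.
Proof. by rewrite /disk/= /den; nra. Qed.

Lemma den_neq0 p : disk p -> den p != 0.
Proof. by move/den_gt0/lt0r_neq0. Qed.

Lemma rho_gt0 p : disk p -> 0 < rho p.
Proof.
move=> Dp; rewrite rhoE ?den_neq0// mulr_gt0// exprn_gt0// invr_gt0 den_gt0//.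
Qed.

Lemma open_disk : open (@disk R).
Proof.
rewrite (_ : disk = defect @^-1` [set t | 0 < t]); last first.
  by apply/seteqP; split=> p; rewrite /disk/defect/=; nra.
apply: open_comp => [p _|]; last exact: open_gt.
by have [/differentiable_continuous] := defect_gradient p.
Qed.

(* The pullback of the Euclidean metric by c. *)
Definition metric p : 'M[R]_2 := (rho p)%:M.

Lemma smooth_upto_den k : smooth_upto (@disk R) k (den : _ -> R^o).
Proof.
have X := @smooth_upto_coord R 2 _ open_disk k 0.
have Y := @smooth_upto_coord R 2 _ open_disk k 1.
have X1 := smooth_uptoD open_disk (@smooth_upto_cst _ _ _ open_disk R^o k 1)
  (smooth_uptoM open_disk (@smooth_upto_cst _ _ _ open_disk R^o k (-1)) X).
have := smooth_uptoD open_disk (smooth_uptoM open_disk X1 X1) (smooth_uptoM open_disk Y Y).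
by apply: smooth_upto_eq => //; [exact: open_disk |move=> p _; rewrite /den/=; ring].
Qed.

Lemma smooth_metric : smooth disk metric.
Proof.
apply/smooth_uptoP => k; have oD := open_disk.
have V := smooth_uptoV oD den_neq0 (@smooth_upto_den k).
have := smooth_uptoM oD (@smooth_upto_cst _ _ _ oD R^o k 4) (smooth_uptoM oD V V).
move/(smooth_uptoZl oD (1%:M : 'M[R]_2)); apply: smooth_upto_eq => // p Dp.
by rewrite scale_scalar_mx mulr1 /metric rhoE ?den_neq0//.
Qed.

Lemma partial_metric p i : disk p ->
  partial i metric p = (pair2 (2 * rho p * lcay1 p) (- 2 * rho p * lcay2 p) i)%:M.
Proof.
move=> Dp; apply/matrixP => j k; rewrite partial_mx; last exact: (smooth_metric [::] Dp).
have G := has_gradientM (has_gradient_cst ((j == k)%:R : R) p) (rho_gradient (den_neq0 Dp)).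
have [_ /(_ i)] := G; rewrite mul0r add0r => H; rewrite [RHS]mxE -[RHS]mulr_natl -H.
congr (partial i _ p); apply/funext => q.
by rewrite /metric mxE mulr_natl.
Qed.

Lemma invmx_metric p : invmx (metric p) = ((rho p)^-1)%:M.
Proof. by rewrite /metric invmx_scalar. Qed.

Lemma riemannian_metric_metric : riemannian_metric disk metric.
Proof.
split; [exact: smooth_metric | by move=> p _; rewrite /metric tr_scalar_mx |].
move=> p v Dp v0; rewrite /inner /metric mul_mx_scalar -scalemxAl mxE mulr_gt0 ?rho_gt0//.
rewrite mxE sum_I2 !mxE -!expr2.
rewrite lt0r addr_ge0 ?sqr_ge0// andbT paddr_eq0 ?sqr_ge0// !sqrf_eq0.
apply: contraNN v0 => /andP[/eqP v0 /eqP v1]; apply/eqP/rowP => i.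
by rewrite mxE; case: (I2P i) => ->.
Qed.

(** The gradient of ln |c'|, by Cauchy-Riemann for a logarithm of c'. *)
Definition lcay p : 'I_2 -> R := pair2 (lcay1 p) (- lcay2 p).

Lemma eqI2 : ((0 == 1 :> 'I_2) = false) * ((1 == 0 :> 'I_2) = false).
Proof. by []. Qed.

(* For the conformal factor e^(2 u), Gamma^k_ij is
   delta_kj u_i + delta_ki u_j - delta_ij u_k; here u = ln |c'|. *)
Lemma christoffel_metric p k i j : disk p ->
  christoffel metric p k i j =
  (k == j)%:R * lcay p i + (k == i)%:R * lcay p j - (i == j)%:R * lcay p k.
Proof.
move=> Dp; rewrite /christoffel sum_I2 invmx_metric !partial_metric// !mxE.
have r0 := lt0r_neq0 (rho_gt0 Dp).
case: (I2P i) => ->; case: (I2P j) => ->; case: (I2P k) => ->;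
  rewrite /lcay /pair2 !eqxx ?eqI2 ?mulr1n ?mulr0n;
  move: (rho p) (lcay1 p) (lcay2 p) r0 => r a b r0; by field.
Qed.

(** The Hessian of ln |c'|; it has trace zero because ln |c'| is harmonic. *)
Definition dlcay p (i : 'I_2) : 'I_2 -> R :=
  if i == 0 then pair2 (dcay1 p) (- dcay2 p)
  else pair2 (- dcay2 p) (- dcay1 p).

Lemma lcay_gradient p i : disk p ->
  has_gradient (fun q => lcay q i) p
    (dlcay p i).
Proof.
move=> /den_neq0 D0; case: (I2P i) => ->; rewrite /lcay /dlcay /pair2/=.
  exact: lcay1_gradient.
apply: has_gradient_pair (has_gradientN (lcay2_gradient D0)) _ _ => //.
Qed.

Lemma christoffel_gradient p k i j : disk p ->
  has_gradient (fun q => christoffel metric q k i j : R^o) p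
  (fun l => (k == j)%:R * dlcay p i l + (k == i)%:R * dlcay p j l
     - (i == j)%:R * dlcay p k l).
Proof.
move=> Dp.
have c (b : bool) m := has_gradientM (has_gradient_cst (b%:R : R) p) (lcay_gradient m Dp).
apply: (near_eq_has_gradient (f := fun q =>
  (k == j)%:R * lcay q i + (k == i)%:R * lcay q j - (i == j)%:R * lcay q k)).
  apply: eq_near_on Dp; first exact: open_disk.
  by move=> q Dq; rewrite christoffel_metric.
apply: has_gradient_eq (has_gradientB (has_gradientD (c _ _) (c _ _)) (c _ _)) _ => l.
by rewrite !mul0r !add0r.
Qed.

(** A conformal metric e^(2 u) with u harmonic is flat. In components, substituting c' = l^2 / 2
    makes every curvature coefficient a polynomial in the parts of l that cancels. *)
Lemma flat_metric : flat disk metric.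
Proof.
move=> p l k i j Dp; rewrite /curvature.
have [_ ->] := christoffel_gradient l j k Dp.
have [_ ->] := christoffel_gradient l i k Dp.
rewrite sum_I2 !christoffel_metric//.
case: (I2P i) => ->; case: (I2P j) => ->; case: (I2P k) => ->; case: (I2P l) => ->;
  rewrite /lcay /dlcay /pair2 !eqxx ?eqI2 ?dcay1E ?dcay2E /=;
  move: (lcay1 p) (lcay2 p) => a b; by field.
Qed.

End cayley.

(** * Totally geodesic graphs *)

Section product.
Context {R : realType} {m n : nat}.

(** Both sides are limits of the same difference quotient. *)
Lemma derive_linear (U V W : normedModType R) (L : {linear U -> V}) (f : V -> W) q v :
  'D_v (f \o L) q = 'D_(L v) f (L q).
Proof.
rewrite /derive; set F := fun h : R => _; set G := fun h : R => _.
by rewrite (_ : F = G)//; apply/funext => h; rewrite /F /G/= [L (_ + _)]linearD [L (_ *: _)]linearZ.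
Qed.

Lemma partial_lsubmx_l (W : normedModType R) (f : 'rV[R]_m -> W) i (q : 'rV[R]_(m + n)) :
  partial (lshift n i) (f \o lsubmx) q = partial i f (lsubmx q).
Proof.
rewrite /partial derive_linear; congr ('D_ _ f _).
by apply/rowP => j; rewrite !mxE eq_shift.
Qed.

Lemma partial_lsubmx_r (W : normedModType R) (f : 'rV[R]_m -> W) i (q : 'rV[R]_(m + n)) :
  partial (rshift m i) (f \o lsubmx) q = 0.
Proof.
rewrite /partial derive_linear /= (_ : lsubmx (delta_mx 0 (rshift m i)) = 0 :> 'rV[R]_m) ?derive0//.
by apply/rowP => j; rewrite !mxE eq_shift andbF.
Qed.

Lemma partial_rsubmx_l (W : normedModType R) (f : 'rV[R]_n -> W) i (q : 'rV[R]_(m + n)) :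
  partial (lshift n i) (f \o rsubmx) q = 0.
Proof.
rewrite /partial derive_linear /= (_ : rsubmx (delta_mx 0 (lshift n i)) = 0 :> 'rV[R]_n) ?derive0//.
by apply/rowP => j; rewrite !mxE eq_shift andbF.
Qed.

Lemma partial_rsubmx_r (W : normedModType R) (f : 'rV[R]_n -> W) i (q : 'rV[R]_(m + n)) :
  partial (rshift m i) (f \o rsubmx) q = partial i f (rsubmx q).
Proof.
rewrite /partial derive_linear; congr ('D_ _ f _).
by apply/rowP => j; rewrite !mxE eq_shift.
Qed.

Lemma partial_block_mx k a b c d (A : 'rV[R]_k -> 'M[R]_(a, c)) (B : 'rV[R]_k -> 'M[R]_(a, d))
    (C : 'rV[R]_k -> 'M[R]_(b, c)) (D : 'rV[R]_k -> 'M[R]_(b, d)) i p :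
  differentiable A p -> differentiable B p -> differentiable C p -> differentiable D p ->
  partial i (fun q => block_mx (A q) (B q) (C q) (D q)) p =
  block_mx (partial i A p) (partial i B p) (partial i C p) (partial i D p).
Proof.
move=> dA dB dC dD.
have dF : differentiable (fun q => block_mx (A q) (B q) (C q) (D q)) p.
  apply/differentiable_mxP => x y.
  case: (split_ordP x) => x' ->; case: (split_ordP y) => y' ->.
  - under eq_fun do rewrite block_mxEul; by move/differentiable_mxP : dA; exact.
  - under eq_fun do rewrite block_mxEur; by move/differentiable_mxP : dB; exact.
  - under eq_fun do rewrite block_mxEdl; by move/differentiable_mxP : dC; exact.
  - under eq_fun do rewrite block_mxEdr; by move/differentiable_mxP : dD; exact.
apply/matrixP => x y; rewrite partial_mx//.
case: (split_ordP x) => x' ->; case: (split_ordP y) => y' ->.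
- by rewrite block_mxEul partial_mx//; under eq_fun do rewrite block_mxEul.
- by rewrite block_mxEur partial_mx//; under eq_fun do rewrite block_mxEur.
- by rewrite block_mxEdl partial_mx//; under eq_fun do rewrite block_mxEdl.
- by rewrite block_mxEdr partial_mx//; under eq_fun do rewrite block_mxEdr.
Qed.

Lemma partial_row_mx k (A : 'rV[R]_k -> 'rV[R]_m) (B : 'rV[R]_k -> 'rV[R]_n) i p :
  differentiable A p -> differentiable B p ->
  differentiable (fun q => row_mx (A q) (B q)) p /\
  partial i (fun q => row_mx (A q) (B q)) p = row_mx (partial i A p) (partial i B p).
Proof.
move=> dA dB.
have dF : differentiable (fun q => row_mx (A q) (B q)) p.
  apply/differentiable_mxP => x y; case: (split_ordP y) => y' ->.
  - under eq_fun do rewrite row_mxEl; by move/differentiable_mxP : dA; exact.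
  - under eq_fun do rewrite row_mxEr; by move/differentiable_mxP : dB; exact.
split=> //; apply/matrixP => x y; rewrite partial_mx//; case: (split_ordP y) => y' ->.
- by rewrite row_mxEl partial_mx//; under eq_fun do rewrite row_mxEl.
- by rewrite row_mxEr partial_mx//; under eq_fun do rewrite row_mxEr.
Qed.

Lemma jacobian_row_mx k (A : 'rV[R]_k -> 'rV[R]_m) (B : 'rV[R]_k -> 'rV[R]_n) p :
  differentiable A p -> differentiable B p ->
  'J (fun q => row_mx (A q) (B q)) p = row_mx ('J A p) ('J B p).
Proof.
move=> dA dB; apply/row_matrixP => i.
have [dF eF] := partial_row_mx i dA dB.
by rewrite jacobian_partial// eF row_row_mx !jacobian_partial.
Qed.

Section at_point.
Variables (s1 : 'rV[R]_m -> 'M[R]_m) (s2 : 'rV[R]_n -> 'M[R]_n) (q : 'rV[R]_(m + n)).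
Hypotheses (d1 : differentiable s1 (lsubmx q)) (d2 : differentiable s2 (rsubmx q)).
Hypotheses (u1 : s1 (lsubmx q) \in unitmx) (u2 : s2 (rsubmx q) \in unitmx).

Lemma invmx_product_metric : invmx (product_metric s1 s2 q) =
  block_mx (invmx (s1 (lsubmx q))) 0 0 (invmx (s2 (rsubmx q))).
Proof.
set B := RHS; have BG : B *m product_metric s1 s2 q = 1%:M.
  by rewrite mulmx_block !mul0mx !mulmx0 !mulVmx// !addr0 !add0r -scalar_mx_block.
have [_ uG] := mulmx1_unit BG.
by rewrite -[RHS](mulmxK uG) BG mul1mx.
Qed.

Lemma partial_product_metric_l i : partial (lshift n i) (product_metric s1 s2) q =
  block_mx (partial i s1 (lsubmx q)) 0 0 0.
Proof.
rewrite partial_block_mx; first last.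
- by apply: (differentiable_comp (f := rsubmx)) => //; exact: differentiable_rsubmx.
- exact: differentiable_cst.
- exact: differentiable_cst.
- by apply: (differentiable_comp (f := lsubmx)) => //; exact: differentiable_lsubmx.
rewrite [partial _ _ q in X in block_mx X](partial_lsubmx_l s1).
rewrite [partial _ _ q in X in block_mx _ _ _ X](partial_rsubmx_l s2).
by rewrite /partial !derive_cst.
Qed.

Lemma partial_product_metric_r i : partial (rshift m i) (product_metric s1 s2) q =
  block_mx 0 0 0 (partial i s2 (rsubmx q)).
Proof.
rewrite partial_block_mx; first last.
- by apply: (differentiable_comp (f := rsubmx)) => //; exact: differentiable_rsubmx.
- exact: differentiable_cst.
- exact: differentiable_cst.
- by apply: (differentiable_comp (f := lsubmx)) => //; exact: differentiable_lsubmx.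
rewrite [partial _ _ q in X in block_mx X](partial_lsubmx_r s1).
rewrite [partial _ _ q in X in block_mx _ _ _ X](partial_rsubmx_r s2).
by rewrite /partial !derive_cst.
Qed.

Let partialE := (partial_product_metric_l, partial_product_metric_r).

Lemma christoffel_product_lll k i j :
  christoffel (product_metric s1 s2) q (lshift n k) (lshift n i) (lshift n j) =
  christoffel s1 (lsubmx q) k i j.
Proof.
rewrite /christoffel invmx_product_metric big_split_ord/= !partialE.
rewrite [X in _ + X]big1 ?addr0 => [|l _]; last by rewrite block_mxEur mxE mul0r.
congr (_ * _); apply: eq_bigr => l _; rewrite partialE.
by congr (_ * (_ + _ - _)); exact: block_mxEul.
Qed.

Lemma christoffel_product_rrr k i j :
  christoffel (product_metric s1 s2) q (rshift m k) (rshift m i) (rshift m j) =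
  christoffel s2 (rsubmx q) k i j.
Proof.
rewrite /christoffel invmx_product_metric big_split_ord/= !partialE.
rewrite [X in X + _]big1 ?add0r => [|l _]; last by rewrite block_mxEdl mxE mul0r.
congr (_ * _); apply: eq_bigr => l _; rewrite partialE.
by congr (_ * (_ + _ - _)); exact: block_mxEdr.
Qed.

Lemma christoffel_product_eq0 k i j :
  (forall l, invmx (product_metric s1 s2 q) k l = 0 \/
    [/\ partial i (product_metric s1 s2) q j l = 0,
        partial j (product_metric s1 s2) q i l = 0 &
        partial l (product_metric s1 s2) q i j = 0]) ->
  christoffel (product_metric s1 s2) q k i j = 0.
Proof.
move=> H; rewrite /christoffel big1 ?mulr0// => l _.
have zero (x a b c : R) : x = 0 \/ [/\ a = 0, b = 0 & c = 0] -> x * (a + b - c) = 0.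
  by move=> [->|[-> -> ->]]; rewrite ?mul0r// !addr0 subr0 mulr0.
exact: zero (H l).
Qed.

Lemma invmx_product_lr k l : invmx (product_metric s1 s2 q) (lshift n k) (rshift m l) = 0.
Proof. by rewrite invmx_product_metric block_mxEur mxE. Qed.

Lemma invmx_product_rl k l : invmx (product_metric s1 s2 q) (rshift m k) (lshift n l) = 0.
Proof. by rewrite invmx_product_metric block_mxEdl mxE. Qed.

Lemma partial_product_lr i j k : partial i (product_metric s1 s2) q (lshift n j) (rshift m k) = 0.
Proof. by case: (split_ordP i) => l ->; rewrite partialE block_mxEur mxE. Qed.

Lemma partial_product_rl i j k : partial i (product_metric s1 s2) q (rshift m j) (lshift n k) = 0.
Proof. by case: (split_ordP i) => l ->; rewrite partialE block_mxEdl mxE. Qed.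

Lemma partial_product_lrr i j k :
  partial (lshift n i) (product_metric s1 s2) q (rshift m j) (rshift m k) = 0.
Proof. by rewrite partialE block_mxEdr mxE. Qed.

Lemma partial_product_rll i j k :
  partial (rshift m i) (product_metric s1 s2) q (lshift n j) (lshift n k) = 0.
Proof. by rewrite partialE block_mxEul mxE. Qed.

(** The inverse metric is block diagonal, so only summands with [l] in the same factor as [k]
    survive. In those, each derivative is of an off-diagonal entry or differentiates the metric of
    one factor along the other. *)
Lemma christoffel_product_mixed (G := christoffel (product_metric s1 s2) q) :
  [/\ forall k i j, G (lshift n k) (lshift n i) (rshift m j) = 0,
      forall k i j, G (lshift n k) (rshift m i) (lshift n j) = 0 &
      forall k i j, G (lshift n k) (rshift m i) (rshift m j) = 0] /\
  [/\ forall k i j, G (rshift m k) (rshift m i) (lshift n j) = 0,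
      forall k i j, G (rshift m k) (lshift n i) (rshift m j) = 0 &
      forall k i j, G (rshift m k) (lshift n i) (lshift n j) = 0].
Proof.
have L k i j : (forall l, [/\ partial i (product_metric s1 s2) q j (lshift n l) = 0,
    partial j (product_metric s1 s2) q i (lshift n l) = 0 &
    partial (lshift n l) (product_metric s1 s2) q i j = 0]) ->
    christoffel (product_metric s1 s2) q (lshift n k) i j = 0.
  move=> H; apply: christoffel_product_eq0 => l.
  by case: (split_ordP l) => {}l ->; [right; exact: H | left; exact: invmx_product_lr].
have D k i j : (forall l, [/\ partial i (product_metric s1 s2) q j (rshift m l) = 0,
    partial j (product_metric s1 s2) q i (rshift m l) = 0 &
    partial (rshift m l) (product_metric s1 s2) q i j = 0]) ->
    christoffel (product_metric s1 s2) q (rshift m k) i j = 0.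
  move=> H; apply: christoffel_product_eq0 => l.
  by case: (split_ordP l) => {}l ->; [left; exact: invmx_product_rl | right; exact: H].
split; split=> k i j.
- apply: L => l;
  split; [exact: partial_product_rl|exact: partial_product_rll|exact: partial_product_lr].
- apply: L => l;
  split; [exact: partial_product_rll|exact: partial_product_rl|exact: partial_product_rl].
- apply: L => l;
  split; [exact: partial_product_rl|exact: partial_product_rl|exact: partial_product_lrr].
- apply: D => l;
  split; [exact: partial_product_lr|exact: partial_product_lrr|exact: partial_product_rl].
- apply: D => l;
  split; [exact: partial_product_lrr|exact: partial_product_lr|exact: partial_product_lr].
- apply: D => l;
  split; [exact: partial_product_lr|exact: partial_product_lr|exact: partial_product_rll].
Qed.
End at_point.

(** The covariant derivative splits because the mixed Christoffel symbols vanish. Differentiability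
    is asked near [p] because the formula for the first derivative is itself differentiated. *)
Lemma covariant2_row_mx k s1 s2 (A : 'rV[R]_k -> 'rV[R]_m) (B : 'rV[R]_k -> 'rV[R]_n) p i j :
  differentiable s1 (A p) -> differentiable s2 (B p) ->
  s1 (A p) \in unitmx -> s2 (B p) \in unitmx ->
  {near p, forall q, differentiable A q /\ differentiable B q} ->
  differentiable (partial j A) p -> differentiable (partial j B) p ->
  covariant2 (product_metric s1 s2) (fun q => row_mx (A q) (B q)) p i j =
  row_mx (covariant2 s1 A p i j) (covariant2 s2 B p i j).
Proof.
move=> d1 d2 u1 u2 dAB dA' dB'.
have [dA dB] := nbhs_singleton dAB.
have e : {near p, partial j (fun q => row_mx (A q) (B q)) =1
    fun q => row_mx (partial j A q) (partial j B q)}.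
  by apply: filterS dAB => q [dAq dBq]; have [] := partial_row_mx j dAq dBq.
rewrite /covariant2 {1}/partial (near_eq_derive _ e).
have [_] := partial_row_mx i dA' dB'.
rewrite {1}/partial => ->; rewrite jacobian_row_mx//.
have L : lsubmx (row_mx (A p) (B p)) = A p by rewrite row_mxKl.
have H : rsubmx (row_mx (A p) (B p)) = B p by rewrite row_mxKr.
rewrite -L in d1 u1; rewrite -H in d2 u2.
have [[M1 M2 M3] [N1 N2 N3]] := christoffel_product_mixed d1 d2 u1 u2.
apply/rowP => a; rewrite mxE; case: (split_ordP a) => {}a ->.
- rewrite 2!row_mxEl [RHS]mxE; congr (_ + _); rewrite [LHS]mxE [RHS]mxE.
  rewrite big_split_ord/= [X in _ + X]big1 ?addr0 => [|b _]; last first.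
    rewrite big1// => c _; case: (split_ordP c) => {}c ->;
      by rewrite ?M2 ?M3 !mul0r.
  apply: eq_bigr => b _; rewrite big_split_ord/= [X in _ + X]big1 ?addr0 => [|c _]; last first.
    by rewrite M1 !mul0r.
  by apply: eq_bigr => c _; rewrite christoffel_product_lll// L 2!row_mxEl.
- rewrite 2!row_mxEr [RHS]mxE; congr (_ + _); rewrite [LHS]mxE [RHS]mxE.
  rewrite big_split_ord/= [X in X + _]big1 ?add0r => [|b _]; last first.
    rewrite big1// => c _; case: (split_ordP c) => {}c ->;
      by rewrite ?N2 ?N3 !mul0r.
  apply: eq_bigr => b _; rewrite big_split_ord/= [X in X + _]big1 ?add0r => [|c _]; last first.
    by rewrite N1 !mul0r.
  by apply: eq_bigr => c _; rewrite christoffel_product_rrr// H 2!row_mxEr.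
Qed.
End product.

Section totally_geodesic.
Context {R : realType}.

(** If all covariant derivatives are tangent, each of them pairs to zero with a normal vector, so
    the trace vanishes term by term. *)
Lemma totally_geodesic_minimal m n (U : set 'rV[R]_m) g (F : 'rV[R]_m -> 'rV[R]_n)
    (c : 'rV[R]_m -> 'I_m -> 'I_m -> 'I_m -> R) :
  (forall p i j, U p ->
    covariant2 g F p i j = \sum_k c p k i j *: row k ('J F p)) ->
  minimal_immersion U g F.
Proof.
move=> FE p N Up N0; rewrite /mean_curvature big1// => i _; rewrite big1// => j _.
rewrite FE// /inner !mulmx_suml summxE big1 ?mulr0// => k _.
by rewrite -!scalemxAl mxE -[X in _ * X]/(inner g (F p) (row k ('J F p)) N) N0 mulr0.
Qed.

Lemma jacobian_id m (p : 'rV[R]_m) : 'J (@id 'rV[R]_m) p = 1%:M.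
Proof.
apply/row_matrixP => i; rewrite jacobian_partial//.
by rewrite /partial derive_id row1.
Qed.

Lemma covariant2_id m (g : 'rV[R]_m -> 'M[R]_m) p i j :
  covariant2 g id p i j = \row_a christoffel g p a i j.
Proof.
rewrite /covariant2.
have -> : partial j (@id 'rV[R]_m) = cst (delta_mx 0 j).
  by apply/funext => q; rewrite /partial derive_id.
rewrite /partial derive_cst add0r; apply/rowP => a; rewrite !mxE jacobian_id.
rewrite (bigD1 i)//= (bigD1 j)//= !mxE !eqxx !mulr1.
rewrite big1 ?addr0 => [|c cj]; last by rewrite !mxE eq_sym (negbTE cj) mulr0.
rewrite big1 ?addr0// => b bi; rewrite big1// => c _.
by rewrite !mxE [i == b]eq_sym (negbTE bi) mulr0 mul0r.
Qed.

(* A graph over [U] is totally geodesic when its map intertwines the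
   Levi-Civita connections. *)
Lemma affine_graph_minimal m n (U : set 'rV[R]_m) s1 s2 (f : 'rV[R]_m -> 'rV[R]_n) :
  open U ->
  (forall p, U p -> differentiable s1 p /\ s1 p \in unitmx) ->
  (forall p, U p -> differentiable s2 (f p) /\ s2 (f p) \in unitmx) ->
  smooth U f ->
  (forall p i j, U p -> covariant2 s2 f p i j =
     \sum_k christoffel s1 p k i j *: row k ('J f p)) ->
  minimal_immersion U (product_metric s1 s2) (fun p => row_mx p (f p)).
Proof.
move=> oU h1 h2 sf af.
apply: (totally_geodesic_minimal (c := christoffel s1)) => p i j Up.
have [d1 u1] := h1 _ Up; have [d2 u2] := h2 _ Up.
have dF q : U q -> differentiable (@id 'rV[R]_m) q /\ differentiable f q.
  by move=> Uq; split=> //; exact: (sf [::] _ Uq).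
rewrite (covariant2_row_mx (A := id))//; first last.
- exact: (sf [:: j] _ Up).
- rewrite (_ : partial j _ = cst (delta_mx 0 j)); first exact: differentiable_cst.
  by apply/funext => q; rewrite /partial derive_id.
- by apply: filterS (open_nbhs_nbhs (conj oU Up)) => q; exact: dF.
rewrite af// covariant2_id (@jacobian_row_mx _ m n m id)//; last exact: (dF _ Up).2.
rewrite jacobian_id.
apply/rowP => a; rewrite summxE; case: (split_ordP a) => {}a ->.
- rewrite row_mxEl mxE (bigD1 a)//= big1 ?addr0 => [|k ka].
    by rewrite mxE mxE row_mxEl mxE eqxx mulr1.
  by rewrite mxE mxE row_mxEl mxE (negbTE ka) mulr0.
- rewrite row_mxEr summxE; apply: eq_bigr => k _.
  by rewrite mxE mxE [RHS]mxE [X in _ = _ * X]mxE row_mxEr.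
Qed.
End totally_geodesic.

(** * Maps of the disk read in the coordinate c *)

Section cayley_coordinates.
Context {R : realType}.
Implicit Types (p q : 'rV[R]_2) (h : 'rV[R]_2 -> 'rV[R]_2).

Lemma cay_comp_gradient h p : differentiable h p -> disk (h p) ->
  has_gradient (fun q => cay1 (h q)) p
    (fun i => 'J h p i 0 * dcay1 (h p) - 'J h p i 1 * dcay2 (h p)) /\
  has_gradient (fun q => cay2 (h q)) p
    (fun i => 'J h p i 0 * dcay2 (h p) + 'J h p i 1 * dcay1 (h p)).
Proof.
move=> dh /den_neq0 D0; have Jh k := has_gradient_of_row k dh.
split.
- apply: has_gradient_eq (has_gradient_comp (cay1_gradient D0) Jh) _ => i.
  by rewrite sum_I2 /pair2/= mulrN.
- apply: has_gradient_eq (has_gradient_comp (cay2_gradient D0) Jh) _ => i.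
  by rewrite sum_I2 /pair2/=.
Qed.

Lemma dcay_comp_gradient h p : differentiable h p -> disk (h p) ->
  has_gradient (fun q => dcay1 (h q)) p
    (fun i => 'J h p i 0 * (dcay1 (h p) * lcay1 (h p) - dcay2 (h p) * lcay2 (h p))
            - 'J h p i 1 * (dcay1 (h p) * lcay2 (h p) + dcay2 (h p) * lcay1 (h p))) /\
  has_gradient (fun q => dcay2 (h q)) p
    (fun i => 'J h p i 0 * (dcay1 (h p) * lcay2 (h p) + dcay2 (h p) * lcay1 (h p))
            + 'J h p i 1 * (dcay1 (h p) * lcay1 (h p) - dcay2 (h p) * lcay2 (h p))).
Proof.
move=> dh /den_neq0 D0; have Jh k := has_gradient_of_row k dh.
split.
- apply: has_gradient_eq (has_gradient_comp (dcay1_gradient D0) Jh) _ => i.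
  by rewrite sum_I2 /pair2/= mulrN.
- apply: has_gradient_eq (has_gradient_comp (dcay2_gradient D0) Jh) _ => i.
  by rewrite sum_I2 /pair2/=.
Qed.

Lemma pullback_metric h p i j : pullback h metric p i j =
  rho (h p) * ('J h p i 0 * 'J h p j 0 + 'J h p i 1 * 'J h p j 1).
Proof.
rewrite /pullback /metric mul_mx_scalar -scalemxAl mxE mxE sum_I2.
by rewrite (mxE _ _ 0 j) (mxE _ _ 1 j).
Qed.

Section affine.
Variables (f : 'rV[R]_2 -> 'rV[R]_2) (lam : R).
Hypotheses (sf : smooth disk f) (fD : forall p, disk p -> disk (f p)).
Hypothesis cay1f : forall p, disk p -> cay1 (f p) = lam * cay1 p.
Hypothesis cay2f : forall p, disk p -> cay2 (f p) = cay2 p.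

(** The first derivative of c o f = L o c, where L (X, Y) = (lam X, Y). *)
Lemma jacobian_cay p : disk p -> forall i,
  'J f p i 0 * dcay1 (f p) - 'J f p i 1 * dcay2 (f p) =
    lam * pair2 (dcay1 p) (- dcay2 p) i /\
  'J f p i 0 * dcay2 (f p) + 'J f p i 1 * dcay1 (f p) =
    pair2 (dcay2 p) (dcay1 p) i.
Proof.
move=> Dp i; have [G1 G2] := cay_comp_gradient (sf [::] Dp) (fD Dp).
have D0 := den_neq0 Dp.
have H1 := has_gradientM (has_gradient_cst lam p) (cay1_gradient D0).
have H2 := cay2_gradient D0.
split.
- have [_ <-] := near_eq_has_gradient (eq_near_on open_disk cay1f Dp) G1.
  by have [_ ->] := H1; rewrite mul0r add0r.
- have [_ <-] := near_eq_has_gradient (eq_near_on open_disk cay2f Dp) G2.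
  by have [_ ->] := H2.
Qed.

(** The relations of [jacobian_cay] differentiated along i: [D1], [D2] are the derivatives of the
    parts of c' o f, and [d1], [d2] those of the parts of c'. *)
Lemma hessian_cay p : disk p -> forall i j,
  let P b := partial i (partial j f) p 0 b in
  let D1 := 'J f p i 0 * (dcay1 (f p) * lcay1 (f p) - dcay2 (f p) * lcay2 (f p))
            - 'J f p i 1 * (dcay1 (f p) * lcay2 (f p) + dcay2 (f p) * lcay1 (f p)) in
  let D2 := 'J f p i 0 * (dcay1 (f p) * lcay2 (f p) + dcay2 (f p) * lcay1 (f p))
            + 'J f p i 1 * (dcay1 (f p) * lcay1 (f p) - dcay2 (f p) * lcay2 (f p)) in
  let d1 := pair2 (dcay1 p * lcay1 p - dcay2 p * lcay2 p)
                            (- (dcay1 p * lcay2 p + dcay2 p * lcay1 p)) i in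
  let d2 := pair2 (dcay1 p * lcay2 p + dcay2 p * lcay1 p)
                            (dcay1 p * lcay1 p - dcay2 p * lcay2 p) i in
  P 0 * dcay1 (f p) + 'J f p j 0 * D1 - (P 1 * dcay2 (f p) + 'J f p j 1 * D2) =
    lam * pair2 d1 (- d2) j /\
  P 0 * dcay2 (f p) + 'J f p j 0 * D2 + (P 1 * dcay1 (f p) + 'J f p j 1 * D1) =
    pair2 d2 d1 j.
Proof.
move=> Dp i j P D1 D2 d1 d2.
have JE b q : disk q -> 'J f q j b = partial j f q 0 b.
  by move=> Dq; rewrite -jacobian_partial ?mxE//; exact: (sf [::] Dq).
have [A1 A2] := dcay_comp_gradient (sf [::] Dp) (fD Dp).
have dP := sf [:: j] Dp.
have Jb b : has_gradient (fun q => 'J f q j b) p (fun i => partial i (partial j f) p 0 b).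
  apply: near_eq_has_gradient; first
    exact: (eq_near_on open_disk (fun q Dq => esym (JE b q Dq)) Dp).
  apply: has_gradient_eq (has_gradient_of_row b dP) _ => l.
  by rewrite -jacobian_partial ?mxE.
have D0 := den_neq0 Dp.
have c1 := dcay1_gradient D0; have c2 := dcay2_gradient D0.
split.
- have G := has_gradientB (has_gradientM (Jb 0) A1) (has_gradientM (Jb 1) A2).
  have e : forall q, disk q -> 'J f q j 0 * dcay1 (f q) - 'J f q j 1 * dcay2 (f q) =
    lam * pair2 (dcay1 q) (- dcay2 q) j.
    by move=> q Dq; case: (jacobian_cay Dq j).
  have [_ /(_ i) <-] := near_eq_has_gradient (eq_near_on open_disk e Dp) G.
  rewrite /pair2; case: (I2P j) => -> /=.
    have [_ ->] := has_gradientM (has_gradient_cst lam p) c1.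
    by rewrite mul0r add0r.
  have [_ ->] := has_gradientM (has_gradient_cst lam p) (has_gradientN c2).
  by rewrite mul0r add0r.
- have G := has_gradientD (has_gradientM (Jb 0) A2) (has_gradientM (Jb 1) A1).
  have e : forall q, disk q -> 'J f q j 0 * dcay2 (f q) + 'J f q j 1 * dcay1 (f q) =
    pair2 (dcay2 q) (dcay1 q) j.
    by move=> q Dq; case: (jacobian_cay Dq j).
  have [_ /(_ i) <-] := near_eq_has_gradient (eq_near_on open_disk e Dp) G.
  rewrite /pair2; case: (I2P j) => -> /=.
    by have [_ ->] := c2.
  by have [_ ->] := c1.
Qed.

(** Multiplication of x + i y by the nonzero complex number a + i b is injective. *)
Lemma conformal_solve (a b x y : R) : a * a + b * b != 0 ->
  x * a - y * b = 0 -> x * b + y * a = 0 -> x = 0 /\ y = 0.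
Proof.
move=> ab e1 e2; split; apply: (mulfI ab); rewrite mulr0.
- transitivity (a * (x * a - y * b) + b * (x * b + y * a)); first by ring.
  by rewrite e1 e2 !mulr0 addr0.
- transitivity (a * (x * b + y * a) - b * (x * a - y * b)); first by ring.
  by rewrite e1 e2 !mulr0 subr0.
Qed.

(* Differentiating c o f = L o c twice, where L is linear, shows that f
   intertwines the Levi-Civita connections. *)
Lemma cay_affine p i j : disk p ->
  covariant2 metric f p i j = \sum_k christoffel metric p k i j *: row k ('J f p).
Proof.
move=> Dp; have Dfp := fD Dp.
have C q a b c := @christoffel_metric R q a b c.
have [H1 H2] := hessian_cay Dp i j.
have [E1 E2] := jacobian_cay Dp 0; have [E3 E4] := jacobian_cay Dp 1.
have r0 := lt0r_neq0 (rho_gt0 Dfp).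
set T := covariant2 _ _ _ _ _; set S := \sum_k _.
have TE a : T 0 a = partial i (partial j f) p 0 a +
  ((christoffel metric (f p) a 0 0 * 'J f p i 0 * 'J f p j 0 +
    christoffel metric (f p) a 0 1 * 'J f p i 0 * 'J f p j 1) +
   (christoffel metric (f p) a 1 0 * 'J f p i 1 * 'J f p j 0 +
    christoffel metric (f p) a 1 1 * 'J f p i 1 * 'J f p j 1)).
  by rewrite /T /covariant2 mxE; congr (_ + _); rewrite mxE !sum_I2.
have SE a : S 0 a = christoffel metric p 0 i j * 'J f p 0 a +
                    christoffel metric p 1 i j * 'J f p 1 a.
  rewrite /S summxE sum_I2; congr (_ + _); by rewrite mxE; congr (_ * _); rewrite mxE.
suff [e0 e1] : T 0 0 - S 0 0 = 0 /\ T 0 1 - S 0 1 = 0.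
  by apply/rowP => a; apply/eqP; rewrite -subr_eq0; case: (I2P a) => ->; apply/eqP.
(* The difference of the two sides is multiplied by c' (f p), nonzero since its squared modulus is
   [rho (f p)]. *)
apply: conformal_solve r0 _ _; rewrite !TE !SE !C//; clear TE SE T S;
move: H1 H2 E1 E2 E3 E4;
move: (partial i (partial j f) p 0 0) (partial i (partial j f) p 0 1) => P0 P1;
case: (I2P i) => ->; case: (I2P j) => ->;
move: ('J f p 0 0) ('J f p 0 1) ('J f p 1 0) ('J f p 1 1) => J00 J01 J10 J11;
rewrite /lcay /pair2 /= ?mulr1n ?mulr0n;
move: (dcay1 (f p)) (dcay2 (f p)) (lcay1 (f p)) (lcay2 (f p)) => a' b' u' v';
move: (dcay1 p) (dcay2 p) (lcay1 p) (lcay2 p) => a b u v H1 H2 E1 E2 E3 E4;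
(* The Christoffel symbols at [f p] are matched by [H1] and [H2]; those at [p] are the first order
   relations times the parts u, v of l. With these products supplied, the goal is linear in the
   monomials. *)
have := congr1 (fun x => u * x) E1; have := congr1 (fun x => u * x) E2;
have := congr1 (fun x => u * x) E3; have := congr1 (fun x => u * x) E4;
have := congr1 (fun x => v * x) E1; have := congr1 (fun x => v * x) E2;
have := congr1 (fun x => v * x) E3; have := congr1 (fun x => v * x) E4;
move=> K1 K2 K3 K4 K5 K6 K7 K8; lra.
Qed.
End affine.
End cayley_coordinates.

(** * Dilations of the half plane *)

Section dilation.
Context {R : realType}.
Implicit Types (p q : 'rV[R]_2) (k : R).

(** The real part, and then the squared modulus, of w = k (1 - |z|^2) + 1 - conj z, whose imaginary
    part is y. It arises from 1 - f = 2 / (c + 1 + 2 k Re c) = |1 - z|^2 / w. *)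
Definition dil_re k p : R := k * defect p + (1 - p 0 0).
Definition dil_sq k p : R := dil_re k p * dil_re k p + p 0 1 * p 0 1.

(* The map that reads [(X, Y) |-> ((1 + 2 k) X, Y)] in the coordinate
   (1 + z) / (1 - z); in complex notation it is
   z |-> 1 - |1 - z|^2 / (k (1 - |z|^2) + 1 - conj z).  At z = 1 the quotient is
   0 / 0, which is 0 here and gives the continuous extension. *)
Definition dil k p : 'rV[R]_2 :=
  (1 + (-1) * (den p * dil_re k p * (dil_sq k p)^-1)) *: delta_mx 0 0 +
  (den p * p 0 1 * (dil_sq k p)^-1) *: delta_mx 0 1.

Lemma dil0E k p : dil k p 0 0 = 1 - den p * dil_re k p / dil_sq k p.
Proof. by rewrite /dil !mxE/= mulr1 mulr0 addr0 mulN1r. Qed.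

Lemma dil1E k p : dil k p 0 1 = den p * p 0 1 / dil_sq k p.
Proof. by rewrite /dil !mxE/= mulr1 mulr0 add0r. Qed.

(** Twice [dil_re] equals (1 + 2 k) [defect] + [den]. Negative k must be covered, since they occur
    for the inverse maps. *)
Lemma dil_re_gt0 k p : 0 < 1 + 2 * k -> disk p -> 0 < dil_re k p.
Proof.
move=> k0 Dp; have N0 : 0 < defect p by move: Dp; rewrite /disk/defect/=; nra.
have : 0 < (1 + 2 * k) * defect p by exact: mulr_gt0.
have := den_gt0 Dp; rewrite /dil_re /defect /den; nra.
Qed.

Lemma dil_sq_gt0 k p : 0 < 1 + 2 * k -> disk p -> 0 < dil_sq k p.
Proof.
move=> k0 Dp; have a0 := dil_re_gt0 k0 Dp.
by rewrite /dil_sq ltr_pwDl ?mulr_gt0// -expr2 sqr_ge0.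
Qed.

Lemma defect_dil k p : dil_sq k p != 0 ->
  defect (dil k p) = den p * ((1 + 2 * k) * defect p) / dil_sq k p.
Proof.
rewrite {1}/defect dil0E dil1E /dil_sq /dil_re => E0.
by rewrite /den /defect in E0 *; field.
Qed.

Lemma den_dil k p : dil_sq k p != 0 ->
  den (dil k p) = den p * den p / dil_sq k p.
Proof.
rewrite {1}/den dil0E dil1E /dil_sq; move: (den p) => d E0.
by field.
Qed.

Lemma dil_disk k p : 0 < 1 + 2 * k -> disk p -> disk (dil k p).
Proof.
move=> k0 Dp; have E0 := dil_sq_gt0 k0 Dp.
have N0 : 0 < defect p by move: Dp; rewrite /disk/defect/=; nra.
have : 0 < defect (dil k p).
  rewrite defect_dil ?lt0r_neq0// !mulr_gt0 ?invr_gt0 ?den_gt0//.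
by rewrite /disk/defect/=; nra.
Qed.

Lemma cay1_dil k p : 0 < 1 + 2 * k -> disk p ->
  cay1 (dil k p) = (1 + 2 * k) * cay1 p.
Proof.
move=> k0 Dp; have E0 := lt0r_neq0 (dil_sq_gt0 k0 Dp); have D0 := den_neq0 Dp.
rewrite /cay1 den_dil// defect_dil//.
by move: (den p) (defect p) (dil_sq k p) D0 E0 => d n e d0 e0; field; rewrite d0.
Qed.

Lemma cay2_dil k p : 0 < 1 + 2 * k -> disk p -> cay2 (dil k p) = cay2 p.
Proof.
move=> k0 Dp; have E0 := lt0r_neq0 (dil_sq_gt0 k0 Dp); have D0 := den_neq0 Dp.
rewrite /cay2 den_dil// dil1E.
by move: (den p) (dil_sq k p) D0 E0 => d e d0 e0; field; rewrite d0.
Qed.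

(** c determines l = c + 1, hence 1 / [den] = |l|^2 / 4; after that the equations for z are
    linear. *)
Lemma cay_inj p q : den p != 0 -> den q != 0 ->
  cay1 p = cay1 q -> cay2 p = cay2 q -> p = q.
Proof.
move=> p0 q0; rewrite !cay1E// => /(addIr _) e1 e2.
have e3 : (den p)^-1 = (den q)^-1.
  have S r : den r != 0 -> (den r)^-1 = (lcay1 r * lcay1 r + lcay2 r * lcay2 r) / 4.
    by rewrite /lcay1 /lcay2 => r0; rewrite /den in r0 *; field.
  by rewrite !S// e1; rewrite /cay2 -/(lcay2 _) in e2; rewrite e2.
have q1 : (den q)^-1 != 0 by rewrite invr_eq0.
move: e1 e2; rewrite /lcay1 /cay2 e3 => /(mulIf q1) e1 /(mulIf q1) e2.
apply/rowP => i; case: (I2P i) => ->; lra.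
Qed.

(** Injectivity of c reduces composition to multiplying the factors 1 + 2 k, with no composition of
    the rational formulas. *)
Lemma dil_comp k l m p : 0 < 1 + 2 * k -> 0 < 1 + 2 * l ->
  1 + 2 * m = (1 + 2 * k) * (1 + 2 * l) -> disk p -> dil k (dil l p) = dil m p.
Proof.
move=> k0 l0 e Dp; have m0 : 0 < 1 + 2 * m by rewrite e mulr_gt0.
have Dl := dil_disk l0 Dp.
apply: cay_inj; rewrite ?den_neq0//; do ?exact: dil_disk.
- by rewrite !cay1_dil// e mulrA.
- by rewrite !cay2_dil.
Qed.

Lemma dil_id p : disk p -> dil 0 p = p.
Proof.
move=> Dp; have z : 0 < 1 + 2 * 0 :> R by rewrite mulr0 addr0.
apply: cay_inj; rewrite ?den_neq0//; do ?exact: dil_disk.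
- by rewrite cay1_dil// mulr0 addr0 mul1r.
- by rewrite cay2_dil.
Qed.

Lemma smooth_dil k : 0 < 1 + 2 * k -> smooth disk (dil k).
Proof.
move=> k0; apply/smooth_uptoP => n; have oD := @open_disk R.
have X := @smooth_upto_coord R 2 _ oD n 0.
have Y := @smooth_upto_coord R 2 _ oD n 1.
have C c := @smooth_upto_cst _ _ _ oD R^o n c.
have D := @smooth_upto_den R n.
have A := smooth_uptoD oD (smooth_uptoM oD (C k) (smooth_uptoD oD (C 1)
  (smooth_uptoM oD (C (-1)) (smooth_uptoD oD (smooth_uptoM oD X X) (smooth_uptoM oD Y Y)))))
  (smooth_uptoD oD (C 1) (smooth_uptoM oD (C (-1)) X)).
have {}A : smooth_upto disk n (dil_re k : _ -> R^o).
  by apply: smooth_upto_eq A => // p _; rewrite /dil_re /defect/=; ring.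
have E := smooth_uptoD oD (smooth_uptoM oD A A) (smooth_uptoM oD Y Y).
have V := smooth_uptoV oD (fun p Dp => lt0r_neq0 (dil_sq_gt0 k0 Dp)) E.
have F0 := smooth_uptoD oD (C 1)
  (smooth_uptoM oD (C (-1)) (smooth_uptoM oD (smooth_uptoM oD D A) V)).
have F1 := smooth_uptoM oD (smooth_uptoM oD D Y) V.
have G0 := smooth_uptoZl oD (delta_mx 0 0 : 'rV[R]_2) F0.
have G1 := smooth_uptoZl oD (delta_mx 0 1 : 'rV[R]_2) F1.
(* [dil] is written with [1 + (-1) * _] and [*:] so that it is literally the function built here. *)
exact: (smooth_uptoD oD G0 G1).
Qed.

(** The choice of [l] makes 1 + 2 l the inverse of 1 + 2 k. *)
Lemma dil_cancel k p : 0 < 1 + 2 * k -> disk p ->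
  let l := - k / (1 + 2 * k) in
  [/\ 0 < 1 + 2 * l, dil l (dil k p) = p & dil k (dil l p) = p].
Proof.
move=> k0 Dp l; have k1 := lt0r_neq0 k0.
have e : (1 + 2 * k) * (1 + 2 * l) = 1 by rewrite /l; field.
have l0 : 0 < 1 + 2 * l by rewrite -(pmulr_rgt0 _ k0) e.
split=> //.
- by rewrite (@dil_comp _ _ 0)// ?dil_id// mulr0 addr0 mulrC e.
- by rewrite (@dil_comp _ _ 0)// ?dil_id// mulr0 addr0 e.
Qed.

Lemma dil_diffeomorphism k : 0 < 1 + 2 * k -> diffeomorphism disk disk (dil k).
Proof.
move=> k0; split; first exact: smooth_dil.
(* The origin serves to extract from [dil_cancel] the sign condition, which does not depend on the
   point. *)
have D0 : disk (0 : 'rV[R]_2) by rewrite /disk/= mxE mxE expr0n/= addr0.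
have [l0 _ _] := dil_cancel k0 D0.
exists (dil (- k / (1 + 2 * k))); split.
- exact: smooth_dil.
- by move=> _ [p Dp <-]; exact: dil_disk.
- by move=> _ [p Dp <-]; exact: dil_disk.
- by move=> p Dp; have [] := dil_cancel k0 Dp.
- by move=> p Dp; have [] := dil_cancel k0 Dp.
Qed.

Lemma dil_minimal k : 0 < 1 + 2 * k -> minimal_diffeomorphism metric metric (dil k).
Proof.
move=> k0; split; first exact: dil_diffeomorphism.
have M p : disk p -> differentiable (@metric R) p /\ metric p \in unitmx.
  move=> Dp; split; first exact: (smooth_metric [::] Dp).
  by rewrite unitmxE /metric det_scalar unitfE expf_neq0// lt0r_neq0// rho_gt0.
apply: affine_graph_minimal => //.
- exact: open_disk.
- by move=> p Dp; apply: M; exact: dil_disk.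
- exact: smooth_dil.
- move=> p i j Dp; apply: (@cay_affine R _ (1 + 2 * k)) => //.
  + exact: smooth_dil.
  + by move=> q; exact: dil_disk.
  + by move=> q; exact: cay1_dil.
  + by move=> q; exact: cay2_dil.
Qed.

End dilation.

(** * Absolute continuity on lines of smooth maps *)

Section lines.
Context {R : realType}.

Lemma is_derive_line n (V : normedModType R) (f : 'rV[R]_n -> V) p v (t : R) :
  derivable f (t *: v + p) v ->
  is_derive t 1 (fun s => f (s *: v + p)) ('D_v f (t *: v + p)).
Proof.
have E : (fun h : R => h^-1 *: (f ((h *: 1 + t) *: v + p) - f (t *: v + p))) =
         (fun h : R => h^-1 *: (f (h *: v + (t *: v + p)) - f (t *: v + p))).
  apply/funext => h; do 2 f_equal; do 1 f_equal.
  by rewrite scalerDl [h *: 1]mulr1 addrA.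
move=> df; split.
  by move: df; rewrite /derivable -E.
by rewrite /derive -E.
Qed.

Lemma line_lipschitz n (f : 'rV[R]_n -> R^o) p v (K a b : R) : a <= b ->
  (forall t, a <= t <= b -> differentiable f (t *: v + p)) ->
  (forall t, a <= t <= b -> `|'D_v f (t *: v + p)| <= K) ->
  `|f (b *: v + p) - f (a *: v + p)| <= K * (b - a).
Proof.
move=> ab df bf.
have d t : a <= t <= b -> is_derive t (1 : R) (fun s => f (s *: v + p) : R^o) ('D_v f (t *: v + p)).
  by move=> t01; apply: is_derive_line; apply: diff_derivable; exact: df.
have [||c cab ->] := @MVT_segment R (fun s => f (s *: v + p)) (fun t => 'D_v f (t *: v + p)) a b ab.
- by move=> t; rewrite in_itv/= => /andP[at_ tb]; apply: d; rewrite !ltW.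
- apply: derivable_within_continuous => t; rewrite in_itv/= => t01.
  by have [] := d _ t01.
- rewrite normrM [X in _ * X]ger0_norm ?subr_ge0// ler_wpM2r ?subr_ge0// bf//.
Qed.

Lemma smooth_coord (U : set 'rV[R]_2) (f : 'rV[R]_2 -> 'rV[R]_2) k p : smooth U f ->
  U p -> differentiable (fun q => f q 0 k : R^o) p.
Proof. by move=> sf /(sf [::]) /= /differentiable_mxP; exact. Qed.

Lemma lipschitz_absolutely_continuous (a b L : R) (c : R -> 'rV[R]_2) : 0 <= L ->
  (forall s t, a <= s -> s <= t -> t <= b -> `|c t - c s| <= L * (t - s)) ->
  absolutely_continuous a b c.
Proof.
move=> L0 cL e e0; have L1 : 0 < L + 1 by rewrite ltr_wpDl.
(* The [+ 1] covers [L = 0] and yields the strict inequality. *)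
exists (e / (L + 1)); first by rewrite divr_gt0.
move=> s /allP sab _ ssd.
apply: (@le_lt_trans _ _ (L * \sum_(I <- s) (I.2 - I.1))).
  rewrite mulr_sumr big_seq [leRHS]big_seq; apply: ler_sum => I Is.
  by have /and3P[? ? ?] := sab _ Is; exact: cL.
apply: (@le_lt_trans _ _ (L * (e / (L + 1)))); first by rewrite ler_wpM2l// ltW.
rewrite mulrA ltr_pdivrMr// [ltRHS]mulrDr mulr1 mulrC ltrDl//.
Qed.

Lemma mx_norm_le2 (u : 'rV[R]_2) (K : R) : 0 <= K -> (forall k, `|u 0 k| <= K) -> `|u| <= K.
Proof.
move=> K0 uK; rewrite [leLHS]/Num.Def.normr/= mx_normrE; apply: bigmax_le => // -[i j] _ /=.
by rewrite ord1.
Qed.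

(** The partial derivative along the segment is continuous, hence bounded on it by compactness, and
    this bound is a Lipschitz constant. *)
Lemma smooth_segment_ac (U : set 'rV[R]_2) (f : 'rV[R]_2 -> 'rV[R]_2) p i (a b : R) :
  smooth U f -> (forall t, a <= t <= b -> U (t *: delta_mx 0 i + p)) ->
  absolutely_continuous a b (fun t => f (t *: delta_mx 0 i + p)).
Proof.
move=> sf abU.
have [ba|ab] := ltP b a.
  apply: (@lipschitz_absolutely_continuous _ _ 0) => // s t s0 st tb.
  by have := lt_le_trans ba (le_trans s0 (le_trans st tb)); rewrite ltxx.
pose g k t := partial i f (t *: delta_mx 0 i + p) 0 k.
have gE k t : a <= t <= b -> g k t = partial i (fun q => f q 0 k : R^o) (t *: delta_mx 0 i + p).
  by move=> t01; rewrite /g partial_mx//; exact: (sf [::] _ (abU _ t01)).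
have gc k : {within `[a, b], continuous (fun t => `|g k t|)}.
  apply: continuous_in_subspaceT => t; rewrite inE/= in_itv/= => t01.
  apply: (@continuous_comp _ _ _ (g k) Num.norm); last exact: norm_continuous.
  have : {for t, continuous (partial i f \o (fun t => t *: delta_mx 0 i + p))}.
    apply: continuous_comp; last exact: differentiable_continuous (sf [:: i] _ (abU _ t01)).
    by apply: cvgD; [apply: scalel_continuous | exact: cvg_cst].
  move=> c; apply: (@continuous_comp _ _ _ (partial i f \o (fun t => t *: delta_mx 0 i + p))
    (fun M : 'rV[R]_2 => M 0 k) t c); exact: coord_continuous.
have [c0 _ c0P] := EVT_max ab (gc 0); have [c1 _ c1P] := EVT_max ab (gc 1).
have bd k t : a <= t <= b -> `|g k t| <= `|g 0 c0| + `|g 1 c1|.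
  move=> t01; have t01' : t \in `[a, b] by rewrite in_itv.
  case: (I2P k) => ->.
    by rewrite (le_trans (c0P _ t01'))// lerDl.
  by rewrite (le_trans (c1P _ t01'))// lerDr.
have K0 : 0 <= `|g 0 c0| + `|g 1 c1| by rewrite addr_ge0.
apply: (lipschitz_absolutely_continuous K0) => s t as_ st tb.
have sub r : s <= r <= t -> a <= r <= b.
  by move=> /andP[sr rt]; rewrite (le_trans as_ sr) (le_trans rt tb).
apply: mx_norm_le2 => [|k]; first by rewrite mulr_ge0 ?subr_ge0.
rewrite !mxE; apply: (line_lipschitz (f := fun q => f q 0 k : R^o) st) => r /sub r01.
  exact: smooth_coord sf (abU _ r01).
by rewrite -[X in `|X|](gE k _ r01) bd.
Qed.

Lemma xyE (x y : R) : xy x y = x *: delta_mx 0 0 + xy 0 y /\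
  xy x y = y *: delta_mx 0 1 + xy x 0.
Proof.
by split; apply/rowP => i; rewrite !mxE; case: (I2P i) => ->;
  rewrite /= ?mulr1 ?mulr0 ?addr0 ?add0r.
Qed.

Lemma smooth_acl (U : set 'rV[R]_2) (f : 'rV[R]_2 -> 'rV[R]_2) :
  smooth U f -> absolutely_continuous_on_lines U f.
Proof.
move=> sf a b c d ab cd abcd; split; apply: aeW.
- move=> y yc; rewrite (_ : (fun x => _) = fun x => f (x *: delta_mx 0 0 + xy 0 y)); last first.
    by apply/funext => x; rewrite -(xyE x y).1.
  by apply: smooth_segment_ac sf _ => x xab; rewrite -(xyE x y).1; exact: abcd.
- move=> x xa; rewrite (_ : (fun y => _) = fun y => f (y *: delta_mx 0 1 + xy x 0)); last first.
    by apply/funext => y; rewrite -(xyE x y).2.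
  by apply: smooth_segment_ac sf _ => y ycd; rewrite -(xyE x y).2; exact: abcd.
Qed.

Lemma smooth_within_continuous n (V : normedModType R) (U : set 'rV[R]_n) (f : 'rV[R]_n -> V) :
  smooth U f -> {within U, continuous f}.
Proof.
move=> sf; apply: continuous_in_subspaceT => p; rewrite inE => Up.
exact: differentiable_continuous (sf [::] _ Up).
Qed.

Lemma diffeomorphism_homeomorphism n (U V : set 'rV[R]_n) f :
  diffeomorphism U V f -> homeomorphism U V f.
Proof.
move=> [sf [g [sg fU gV gf fg]]]; split; first exact: smooth_within_continuous.
by exists g; split => //; exact: smooth_within_continuous.
Qed.

End lines.

(** * Quasiconformality of the dilations *)

Section dilatation.
Context {R : realType}.
Local Open Scope complex_scope.

Lemma complex_half (a b : R) : (a +i* b) / 2%:R = (a / 2) +i* (b / 2).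
Proof.
have -> : (2%:R : R[i]) = (2 : R)%:C by rewrite rmorph_nat.
by rewrite -fmorphV; simpc.
Qed.

Lemma dzE (f : 'rV[R]_2 -> 'rV[R]_2) p : differentiable f p ->
  dz f p = (('J f p 0 0 + 'J f p 1 1) / 2) +i* (('J f p 0 1 - 'J f p 1 0) / 2).
Proof.
move=> df; rewrite /dz -complex_half /complex_of -!jacobian_partial// !(mxE _ _ 0).
by congr (_ / _); simpc.
Qed.

Lemma dzbarE (f : 'rV[R]_2 -> 'rV[R]_2) p : differentiable f p ->
  dzbar f p = (('J f p 0 0 - 'J f p 1 1) / 2) +i* (('J f p 0 1 + 'J f p 1 0) / 2).
Proof.
move=> df; rewrite /dzbar -complex_half /complex_of -!jacobian_partial// !(mxE _ _ 0).
by congr (_ / _); simpc.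
Qed.

(** Since c is holomorphic, the dilatation is that of (X, Y) |-> (lambda X, Y), namely (lambda - 1)
    / (lambda + 1) = k / (1 + k) for lambda = 1 + 2 k. *)
Lemma dil_dilatation (k : R) p : 0 <= k -> disk p ->
  Normc.normc (dzbar (dil k) p) <= k / (1 + k) * Normc.normc (dz (dil k) p).
Proof.
move=> k0 Dp; have k2 : 0 < 1 + 2 * k by rewrite ltr_wpDr ?mulr_ge0.
have k1 : 0 < 1 + k by rewrite ltr_wpDr.
have sf := smooth_dil k2.
have fD : forall q, disk q -> disk (dil k q) by move=> q; exact: dil_disk.
have [E1 E2] := jacobian_cay sf fD (fun q => @cay1_dil _ k q k2) (fun q => @cay2_dil _ k q k2) Dp 0.
have [E3 E4] := jacobian_cay sf fD (fun q => @cay1_dil _ k q k2) (fun q => @cay2_dil _ k q k2) Dp 1.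
rewrite dzE ?dzbarE; try exact: (sf [::] _ Dp).
have r0 := rho_gt0 (fD _ Dp); move: r0 E1 E2 E3 E4; rewrite /rho /pair2/=.
move: ('J (dil k) p 0 0) ('J (dil k) p 0 1) ('J (dil k) p 1 0) ('J (dil k) p 1 1) => A B C D.
move: (dcay1 (dil k p)) (dcay2 (dil k p)) (dcay1 p) (dcay2 p) => a' b' a b r0 E1 E2 E3 E4.
have c0 : 0 <= k / (1 + k) by rewrite divr_ge0// ltW.
rewrite -[k / _]ger0_norm// -sqrtr_sqr -sqrtrM ?sqr_ge0// ler_wsqrtr//.
rewrite [X in _ <= X * _]expr_div_n [leRHS]mulrAC ler_pdivlMr ?exprn_gt0//.
(* Equality holds. Multiplying by |c' (f p)|^2 expresses both sides through the relations [E1] to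
   [E4]. *)
rewrite -(ler_pM2r r0) le_eqVlt; apply/orP; left; apply/eqP.
transitivity ((((A * a' - B * b' - (C * b' + D * a')) ^+ 2 +
   (A * b' + B * a' + (C * a' - D * b')) ^+ 2)) / 4 * (1 + k) ^+ 2); first by field.
transitivity (k ^+ 2 * ((A * a' - B * b' + (C * b' + D * a')) ^+ 2 +
   (A * b' + B * a' - (C * a' - D * b')) ^+ 2) / 4); last by field.
by rewrite E1 E2 E3 E4; field.
Qed.

Lemma dil_quasiconformal (k : R) : 0 <= k -> quasiconformal disk disk (dil k).
Proof.
move=> k0; have k2 : 0 < 1 + 2 * k by rewrite ltr_wpDr ?mulr_ge0.
split.
- exact/diffeomorphism_homeomorphism/dil_diffeomorphism.
- exact/smooth_acl/smooth_dil.
exists (k / (1 + k)); have k1 : 0 < 1 + k by rewrite ltr_wpDr.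
split.
  by rewrite divr_ge0// ?(ltW k1)//= ltr_pdivrMr// mul1r ltrDr.
by apply: aeW => z Dz; exact: dil_dilatation.
Qed.

End dilatation.

(** * Continuous extension to the circle *)

Section boundary.
Context {R : realType}.

Lemma den_ge0 (p : 'rV[R]_2) : 0 <= den p.
Proof. by rewrite /den -!expr2 addr_ge0 ?sqr_ge0. Qed.

Lemma den_eq0 (p : 'rV[R]_2) : den p = 0 -> p 0 0 = 1 /\ p 0 1 = 0.
Proof.
rewrite /den -!expr2 => /eqP; rewrite paddr_eq0 ?sqr_ge0// !sqrf_eq0 subr_eq0.
by move=> /andP[/eqP <- /eqP].
Qed.

Lemma dil_circle (k : R) p : circle p -> dil k p = p.
Proof.
rewrite /circle/= => Cp.
have N0 : defect p = 0 by move: Cp; rewrite /defect/=; lra.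
have a : dil_re k p = 1 - p 0 0 by rewrite /dil_re N0 mulr0 add0r.
have E : dil_sq k p = den p by rewrite /dil_sq a.
apply/rowP => i; case: (I2P i) => ->; rewrite ?dil0E ?dil1E ?a E.
  have [d0|d0] := eqVneq (den p) 0; last by field.
  by rewrite d0 !mul0r subr0; have [-> _] := den_eq0 d0.
have [d0|d0] := eqVneq (den p) 0; last by field.
by rewrite d0 !mul0r; have [_ ->] := den_eq0 d0.
Qed.

Lemma dil_sq_ge (k : R) p : 0 <= k -> closed_disk p -> den p <= dil_sq k p.
Proof.
rewrite /closed_disk/= => k0 Dp.
have x1 : 0 <= 1 - p 0 0.
  by rewrite subr_ge0 leNgt; apply/negP => x1; have := sqr_ge0 (p 0 1); nra.
have N0 : 0 <= k * defect p by rewrite mulr_ge0// /defect; lra.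
by rewrite /dil_sq /den lerD2r /dil_re ler_pM// lerDr.
Qed.

(** |1 - f|^2 = |1 - z|^4 / |w|^2 and |w| >= |1 - z|. This gives continuity at z = 1, the only point
    of the closed disk where w vanishes. *)
Lemma dil_dist_sqr (k : R) p : 0 <= k -> closed_disk p ->
  (1 - dil k p 0 0) ^+ 2 + (dil k p 0 1) ^+ 2 <= den p.
Proof.
move=> k0 Dp; rewrite dil0E dil1E.
have dE := dil_sq_ge k0 Dp.
have d0 := den_ge0 p.
have [E0|E0] := eqVneq (dil_sq k p) 0.
  by rewrite E0 invr0 !mulr0 subr0 subrr expr0n addr0.
have E1 : 0 < dil_sq k p by rewrite lt_neqAle eq_sym E0 (le_trans d0).
rewrite [leLHS](_ : _ = den p * (den p / dil_sq k p)).
  by rewrite ler_piMr// ler_pdivrMr// mul1r.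
move: E0; rewrite /dil_sq; move: (den p) (dil_re k p) (p 0 1) => d a y E0; field.
exact: E0.
Qed.

Lemma dil_differentiable (k : R) p : dil_sq k p != 0 -> differentiable (dil k) p.
Proof.
move=> E0.
have Gx := has_gradient_coord 0 p; have Gy := has_gradient_coord 1 p.
have G1 := has_gradientB (has_gradient_cst 1 p) Gx.
have Ga := has_gradientD (has_gradientM (has_gradient_cst k p) (defect_gradient p)) G1.
have GE := has_gradientD (has_gradientM Ga Ga) (has_gradientM Gy Gy).
have GV := has_gradientV GE E0.
have F0 := has_gradientB (has_gradient_cst 1 p)
  (has_gradientM (has_gradientM (den_gradient p) Ga) GV).
have F1 := has_gradientM (has_gradientM (den_gradient p) Gy) GV.
apply/differentiable_mxP => i j; rewrite ord1; case: (I2P j) => ->.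
- by case: F0 => + _; apply: near_eq_differentiable; near=> q; rewrite dil0E.
- by case: F1 => + _; apply: near_eq_differentiable; near=> q; rewrite dil1E.
Unshelve. all: by end_near. Qed.

Lemma dil_continuous_closed (k : R) : 0 <= k -> {within closed_disk, continuous (dil k)}.
Proof.
move=> k0; apply/subspace_continuousP => p Dp.
have [E0|E0] := eqVneq (dil_sq k p) 0; last first.
  apply: cvg_within_filter; exact: differentiable_continuous (dil_differentiable E0).
have d0 : den p = 0.
  by apply/eqP; rewrite eq_le den_ge0 andbT -E0; exact: dil_sq_ge.
have [px py] := den_eq0 d0.
have fp : dil k p = p.
  apply/rowP => i; case: (I2P i) => ->; rewrite ?dil0E ?dil1E d0 !mul0r ?subr0 ?px ?py//.
apply/cvgrPdist_le => e e0; near=> q.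
rewrite -[leLHS]/(`|dil k p - dil k q|) fp.
have Dq : closed_disk q by near: q; exact: withinT.
have pq : `|p - q| < e / 2.
  near: q; apply: cvg_within.
  by apply: (@cvgr_dist_lt _ _ _ (nbhs p) _ id p) => //; rewrite divr_gt0.
have qk j : `|p 0 j - q 0 j| < e / 2.
  apply: le_lt_trans pq; rewrite [leRHS]/Num.Def.normr/= mx_normrE.
  by apply: le_trans; last exact: (le_bigmax _ _ (0, j)); rewrite !mxE.
have := dil_dist_sqr k0 Dq; rewrite /den.
have := qk 0; have := qk 1; rewrite px py sub0r normrN !ltr_norml => /andP[y1 y2] /andP[x1 x2] H.
have {}H : (1 - dil k q 0 0) ^+ 2 + dil k q 0 1 ^+ 2 <= e ^+ 2.
  apply: (le_trans H); nra.
apply: mx_norm_le2 => [|j]; first exact: ltW.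
rewrite -ler_sqr ?nnegrE ?normr_ge0 ?(ltW e0)// real_normK ?num_real//; apply: le_trans H.
rewrite !mxE; case: (I2P j) => ->; rewrite ?px ?py.
  by rewrite lerDl sqr_ge0.
by rewrite sub0r sqrrN lerDr sqr_ge0.
Unshelve. all: by end_near. Qed.

Lemma dil_extends_to_id (k : R) : 0 <= k -> extends_to (dil k) id.
Proof.
by move=> k0; exists (dil k); split=> //; [exact: dil_continuous_closed | exact: dil_circle].
Qed.

Lemma homeomorphism_id n (A : set 'rV[R]_n) : homeomorphism A A id.
Proof.
have c : {within A, continuous (@id 'rV[R]_n)} by apply: continuous_subspaceT => x; exact: cvg_id.
by split => //; exists id; split => // _ [p Ap <-].
Qed.

End boundary.

(** * Infinite area *)

Section area_lower_bound.
Context {R : realType}.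
Local Notation T := (measurableTypeR R * measurableTypeR R)%type.
Local Notation area := (@area R).
Import HBNNSimple.

(* A lower bound for the integral of f over the points of D satisfying A,
   witnessed by a simple function, so that f, D and A need not be measurable. *)
Definition goodset (f : T -> R) (D A : set T) (m : R) :=
  exists h : {nnsfun T >-> R}, (m%:E <= sintegral area h)%E /\
    forall z, h z != 0 -> [/\ D z, A z & h z <= f z].

(** The witness is one of the simple functions whose supremum is the integral of f extended by 0
    outside D. *)
Lemma goodset_le_integral f D A m : (forall z, D z -> 0 <= f z) ->
  goodset f D A m -> (m%:E <= \int[area]_(z in D) (f z)%:E)%E.
Proof.
move=> f0 [h [mh hf]]; apply: (le_trans mh).
rewrite ge0_integralE => [|z Dz]; last by rewrite lee_fin f0.
apply: ereal_sup_ubound; exists h => //= z; rewrite /patch.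
have [h0|h0] := eqVneq (h z) 0.
  by rewrite h0; case: ifPn => [/set_mem Dz|_]; rewrite lee_fin ?f0.
by have [Dz _ hz] := hf z h0; rewrite mem_set// lee_fin.
Qed.

(** Disjointness keeps the sum of the witnesses below f, as at most one of them is nonzero at each
    point. *)
Lemma goodset_union f D A B S m n : goodset f D A m -> goodset f D B n ->
  A `<=` S -> B `<=` S -> (forall z, A z -> B z -> False) ->
  goodset f D S (m + n).
Proof.
move=> [h [mh hf]] [k [nk kf]] AS BS AB; exists (add_nnsfun h k); split.
  rewrite EFinD; apply: (le_trans (leeD mh nk)).
  by rewrite (sintegralD area h k).
move=> z; rewrite /=.
have [h0|h0] := eqVneq (h z) 0; have [k0|k0] := eqVneq (k z) 0.
- by rewrite h0 k0 addr0 eqxx.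
- by have [Dz Bz fz] := kf z k0; rewrite h0 add0r; split=> //; exact: BS.
- by have [Dz Az fz] := hf z h0; rewrite k0 addr0; split=> //; exact: AS.
- by have [_ Az _] := hf z h0; have [_ Bz _] := kf z k0; case: (AB z).
Qed.

Lemma goodset_box f D A (a b s c : R) : 0 < s -> 0 <= c ->
  (forall z, `|z.1 - a| <= s -> `|z.2 - b| <= s -> [/\ D z, A z & c <= f z]) ->
  goodset f D A (c * (4 * s ^+ 2)).
Proof.
move=> s0 c0 H.
have m1 (x : R) : measurable (`[x - s, x + s]%classic : set (measurableTypeR R)) by [].
have mB := measurableX (m1 a) (m1 b).
have L (x : R) : lebesgue_measure (`[x - s, x + s]%classic : set R) = (2 * s)%:E.
  rewrite lebesgue_measure_itv/= lte_fin ltrD2l gtrN// -EFinB; congr EFin; ring.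
have P : area (`[a - s, a + s]%classic `*` `[b - s, b + s]%classic) = (4 * s ^+ 2)%:E.
  transitivity (mule (lebesgue_measure (`[a - s, a + s]%classic : set R))
                     (lebesgue_measure (`[b - s, b + s]%classic : set R))).
    exact: (product_measure1E (@lebesgue_measure R) (@lebesgue_measure R) (m1 a) (m1 b)).
  by rewrite !L -EFinM; congr EFin; ring.
exists (scale_nnsfun (indic_nnsfun R mB) c0); split.
  rewrite (_ : sintegral area _ = c%:E * sintegral area (indic_nnsfun R mB))%E; last first.
    by rewrite -sintegralrM; apply: eq_sintegral.
  rewrite sintegral_indic.
  rewrite [X in (_ * X)%E]P -EFinM lee_fin.
  by rewrite le_eqVlt; apply/orP; left; apply/eqP; ring.
move=> z; set B := (_ `*` _) in mB *.
rewrite (_ : scale_nnsfun _ c0 z = c * (z \in B)%:R)//.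
have [/set_mem [z1 z2] _|_] := boolP (z \in B); last by rewrite mulr0 eqxx.
rewrite mulr1.
move: z1 z2; rewrite /= !in_itv/= => z1 z2.
by apply: H; rewrite ler_distl.
Qed.

End area_lower_bound.

Section infinite_area.
Context {R : realType}.
Implicit Types (p q x y : 'rV[R]_2).

Lemma norm_coord_le m n (u : 'M[R]_(m, n)) i j : `|u i j| <= `|u|.
Proof.
rewrite [leRHS]/Num.Def.normr/= mx_normrE.
by apply: le_trans; last exact: (le_bigmax _ _ (i, j)).
Qed.

(** Intended use: [v] is a conformal map onto the right half plane, [V] its inverse, [mu] its
    conformal factor and [f] the norm of a Hopf differential. *)
Variables (v V : 'rV[R]_2 -> 'rV[R]_2) (mu f : 'rV[R]_2 -> R) (c : R).
Hypothesis dv : forall p, disk p -> differentiable v p.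
Hypothesis vmu : forall p i j, disk p -> (partial i v p 0 j) ^+ 2 <= mu p.
Hypothesis cmu : forall p, disk p -> {for p, continuous mu}.
Hypothesis mu0 : forall p, disk p -> 0 < mu p.
Hypothesis c0 : 0 < c.
Hypothesis fmu : forall p, disk p -> c * mu p <= f p.
Hypothesis Vv : forall q, 0 < q 0 0 ->
  [/\ disk (V q), v (V q) = q & {for q, continuous V}].

(** Near [p] the values of [mu] are at most 4 [mu p], so each partial derivative of [v] is at most 2
    sqrt ([mu p]); the two directions add up to the constant 4. *)
Lemma local_lipschitz p : disk p -> exists2 r : R, 0 < r &
  (forall x, `|p - x| < r -> disk x /\ mu p / 2 <= mu x) /\
  (forall x y, `|p - x| < r -> `|p - y| < r ->
     `|v y - v x| <= 4 * Num.sqrt (mu p) * `|y - x|).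
Proof.
move=> Dp; have m0 := mu0 Dp.
have [r r0 rP] : exists2 r : R, 0 < r & forall x, `|p - x| < r ->
    [/\ disk x, mu p / 2 <= mu x & mu x <= 4 * mu p].
  have : \forall x \near p, [/\ disk x, mu p / 2 <= mu x & mu x <= 4 * mu p].
    near=> x; split.
    - near: x; exact: open_nbhs_nbhs (conj open_disk Dp).
    - near: x; apply: (cvgr_ge _ (cmu Dp)); lra.
    - near: x; apply: (cvgr_le _ (cmu Dp)); lra.
  by move=> /nbhs_normP[r r0 rP]; exists r => // x px; exact: rP.
exists r => //; split => [x /rP[? ? _]//|x y px py].
have K0 : 0 <= Num.sqrt (mu p) by exact: sqrtr_ge0.
apply: mx_norm_le2 => [|j]; first by rewrite !mulr_ge0.
set w := y - x.
have xy t : 0 <= t <= 1 -> `|p - (t *: w + x)| < r.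
  move=> /andP[t0 t1].
  have -> : p - (t *: w + x) = (1 - t) *: (p - x) + t *: (p - y).
    rewrite /w !scalerBr scalerBl scale1r !scalerBl !scale1r.
    by apply/rowP => i; rewrite !mxE; ring.
  apply: (le_lt_trans (ler_normD _ _)); rewrite !normrZ !ger0_norm ?subr_ge0//.
  have [->|tn0] := eqVneq t 0; first by rewrite subr0 mul1r mul0r addr0.
  have {tn0}t0 : 0 < t by rewrite lt_neqAle eq_sym tn0.
  apply: (@le_lt_trans _ _ ((1 - t) * r + t * `|p - y|)).
    by rewrite lerD2r ler_wpM2l ?subr_ge0// ltW.
  have tr : t * `|p - y| < t * r by rewrite ltr_pM2l.
  lra.
have -> : (v y - v x) 0 j = (v (1 *: w + x)) 0 j - (v (0 *: w + x)) 0 j.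
  by rewrite scale1r scale0r add0r /w subrK !mxE.
have G t : 0 <= t <= 1 -> has_gradient (fun q => v q 0 j) (t *: w + x)
    (fun i => partial i v (t *: w + x) 0 j).
  move=> /xy/rP[Dt _ _]; apply: has_gradient_eq (has_gradient_of_row j (dv Dt)) _ => i.
  by rewrite -jacobian_partial ?mxE//; exact: dv.
have -> : 4 * Num.sqrt (mu p) * `|w| = 4 * Num.sqrt (mu p) * `|w| * (1 - 0) by rewrite subr0 mulr1.
apply: (line_lipschitz (f := fun q => v q 0 j : R^o)) => // t t01; first by have [] := G t t01.
rewrite (has_gradient_derive _ (G t t01)) sum_I2.
have B i : `|w 0 i * partial i v (t *: w + x) 0 j| <= `|w| * (2 * Num.sqrt (mu p)).
  rewrite normrM ler_pM ?norm_coord_le//.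
  have [Dt _ m4] := rP _ (xy t t01).
  rewrite -ler_sqr ?nnegrE ?mulr_ge0// real_normK ?num_real//.
  rewrite (le_trans (vmu _ _ Dt))// exprMn sqr_sqrtr ?(ltW m0)//; lra.
apply: (le_trans (ler_normD _ _)); apply: (le_trans (lerD (B 0) (B 1))); lra.
Unshelve. all: by end_near. Qed.

(** Half open, so that four squares of side t tile one of side 2 t without overlap. *)
Definition square q (t : R) : set 'rV[R]_2 :=
  [set y | forall i, q 0 i <= y 0 i < q 0 i + t].

Let pull (A : set 'rV[R]_2) : set (R * R) := [set z | A (xy z.1 z.2)].

(** The constant is (c mu / 2) (4 s^2) for the box of half side s = t / (16 sqrt mu) found in
    [local_good]. As mu cancels, the bound is a fixed multiple of the area of the square. *)
Let good q t := goodset (fun z => f (xy z.1 z.2)) (pull disk)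
  (pull (v @^-1` square q t)) (c / 128 * t ^+ 2).

(* The preimage under v of a small square of side t contains a box of side
   about t / sqrt mu, on which the integral of mu is at least a multiple of
   t ^ 2.  This replaces the change of variables formula. *)
Lemma local_good q : 0 < q 0 0 -> exists2 d : R, 0 < d &
  forall q' t, `|q - q'| < d -> 0 < t < d -> good q' t.
Proof.
move=> q0; have [DV vV cV] := Vv q0; have m0 := mu0 DV.
have [r r0 [rP rL]] := local_lipschitz DV.
set p := V q in DV rP rL m0.
set K := 4 * Num.sqrt (mu p); have K0 : 0 < K by rewrite mulr_gt0 ?sqrtr_gt0.
have : \forall y \near q, `|p - V y| < r / 2.
  by move: (cV) => /cvgrPdist_lt; apply; rewrite divr_gt0.
move=> /nbhs_normP[d1 /= d10 d1P].
(* The three bounds keep the center [q2] of the square where [V] is controlled, keep it in the half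
   plane, and keep the box within distance r of [p]. *)
pose d := Num.min (d1 / 2) (Num.min (q 0 0 / 2) (K * r)).
have d0 : 0 < d by rewrite /d !lt_min; apply/and3P; split; [lra|lra|exact: mulr_gt0].
exists d => // q' t qq' /andP[t0 td].
have [dd1 dq dK] : [/\ d <= d1 / 2, d <= q 0 0 / 2 & d <= K * r].
  by rewrite /d; split; rewrite !ge_min lexx ?orbT.
pose q2 := q' + const_mx (t / 2).
have q'q2 : `|q' - q2| <= t / 2.
  rewrite /q2 opprD addrA subrr add0r normrN; apply: mx_norm_le2 => [|k].
    by rewrite divr_ge0// ltW.
  by rewrite mxE ger0_norm// divr_ge0// ltW.
have qq2 : `|q - q2| < d1.
  rewrite -(subrKA q') (le_lt_trans (ler_normD _ _))//; lra.
have q20 : 0 < q2 0 0.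
  rewrite /q2 !mxE; have := le_lt_trans (norm_coord_le (q - q') 0 0) qq'.
  rewrite !mxE ltr_norml => /andP[_ ?]; lra.
have [Dp2 vp2 _] := Vv q20; have pp2 := d1P _ qq2.
set p2 := V q2 in Dp2 vp2 pp2.
(* On the box [v] moves by at most [K * s] = t / 4 from the center of a square of side t, so its
   image stays inside. *)
pose s := t / (4 * K); have s0 : 0 < s by apply: divr_gt0 => //; exact: mulr_gt0.
have Ks : K * s = t / 4 by rewrite /s; field; rewrite lt0r_neq0.
have sr : s < r / 2.
  by rewrite -(ltr_pM2l K0) Ks; lra.
rewrite /good; have -> : c / 128 * t ^+ 2 = (c * (mu p / 2)) * (4 * s ^+ 2).
  have -> : t = 4 * (K * s) by rewrite Ks; field.
  have K2 : K ^+ 2 = 16 * mu p by rewrite /K exprMn sqr_sqrtr ?(ltW m0)//; ring.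
  transitivity (c / 128 * 16 * K ^+ 2 * s ^+ 2); first by ring.
  by rewrite K2; field.
apply: (@goodset_box _ _ _ _ (p2 0 0) (p2 0 1)) => //.
  by rewrite mulr_ge0 ?divr_ge0// ltW.
move=> z z1 z2; set x := xy z.1 z.2.
have xp2 : `|x - p2| <= s.
  apply: mx_norm_le2 => [|k]; first exact: ltW.
  by rewrite !mxE; case: (I2P k) => ->.
have px2 : `|p - p2| < r by lra.
have px : `|p - x| < r.
  rewrite -(subrKA p2) (le_lt_trans (ler_normD _ _))// [X in _ + X]distrC; lra.
have [Dx mx] := rP _ px; split => //.
- move=> i; have := rL _ _ px2 px; rewrite vp2 => /(le_trans (norm_coord_le _ 0 i)) H.
  have {}H : `|(v x - q2) 0 i| <= t / 4.
    by apply: (le_trans H); rewrite -Ks ler_pM2l.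
  by move: H; rewrite !mxE ler_norml => /andP[? ?]; apply/andP; split; lra.
- by apply: le_trans (fmu Dx); rewrite ler_pM2l.
Qed.

(** The four quarters are merged in pairs into the lower and upper halves [L 0] and [L t], and then
    the two halves are merged. *)
Lemma good_double q t : 0 < t ->
  (forall a b, (a == 0) || (a == t) -> (b == 0) || (b == t) -> good (q + xy a b) t) ->
  good q (2 * t).
Proof.
move=> t0 H; rewrite /good.
have t1 : (t == 0) || (t == t) by rewrite eqxx orbT.
have z1 : (0 == 0 :> R) || (0 == t) by rewrite eqxx.
have S a b : (a == 0) || (a == t) -> (b == 0) || (b == t) ->
    pull (v @^-1` square (q + xy a b) t) `<=` pull (v @^-1` square q (2 * t)).
  move=> a0 b0 z /= Hz i; have := Hz i; rewrite !mxE.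
  by case: (I2P i) => -> /=; [move: a0|move: b0] => /orP[] /eqP-> /andP[? ?];
    apply/andP; split; lra.
pose L (b : R) : set (R * R) := fun z => square q (2 * t) (v (xy z.1 z.2)) /\
  (q + xy 0 b) 0 1 <= v (xy z.1 z.2) 0 1 < (q + xy 0 b) 0 1 + t.
have HL b : (b == 0) || (b == t) -> goodset (fun z => f (xy z.1 z.2)) (pull disk)
  (L b) (c / 128 * t ^+ 2 + c / 128 * t ^+ 2).
  move=> b0; apply: (goodset_union (H 0 b z1 b0) (H t b t1 b0)).
  - by move=> z Hz; split; [exact: S Hz | have := Hz 1; rewrite !mxE].
  - by move=> z Hz; split; [exact: S Hz | have := Hz 1; rewrite !mxE].
  - by move=> z /(_ 0) + /(_ 0); rewrite !mxE/= => /andP[? ?] /andP[? ?]; lra.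
have -> : c / 128 * (2 * t) ^+ 2 = (c / 128 * t ^+ 2 + c / 128 * t ^+ 2) +
  (c / 128 * t ^+ 2 + c / 128 * t ^+ 2) by field.
apply: (goodset_union (HL 0 z1) (HL t t1)).
- by move=> z [].
- by move=> z [].
- by move=> z [_ +] [_]; rewrite !mxE/= => /andP[? ?] /andP[? ?]; lra.
Qed.

(** Compactness makes the scale in [local_good] uniform over corners in [1, 1 + M]^2. Squares of
    side M / 2^n are below that scale, and n doublings recover side M. *)
Lemma good_square M : 0 < M -> good (const_mx 1) M.
Proof.
move=> M0.
pose S : set 'rV[R]_2 := [set q | forall i, (`[1, 1 + M]%classic : set R) (q 0 i)].
have cS : compact S.
  by apply: (@rV_compact _ 2 (fun=> `[1, 1 + M]%classic)) => i; exact: segment_compact.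
have /compact_near_coveringP/(_ R 0^'+ (fun t q => good q t)) := cS.
case.
  move=> q qS; have q0 : 0 < q 0 0.
    by have := qS 0; rewrite /= in_itv/= => /andP[? _]; lra.
  have [d d0 dP] := local_good q0.
  exists ([set q' | `|q - q'| < d], [set t | 0 < t < d]) => /=.
    split; first by apply: (@cvgr_dist_lt _ _ _ (nbhs q) _ id q).
    near=> t; apply/andP; split; near: t; first exact: nbhs_right_gt.
    exact: nbhs_right_lt.
  by move=> [q' t] /= [? ?]; exact: dP.
move=> d /= d0 dP.
have [n nP] : exists n : nat, M / 2 ^+ n < d.
  exists (Num.truncn (M / d)).+1; rewrite ltr_pdivrMr ?exprn_gt0// mulrC -ltr_pdivrMr//.
  apply: (lt_trans (truncnS_gt _)).
  by rewrite -natrX ltr_nat ltn_expl.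
have t0 : 0 < M / 2 ^+ n by rewrite divr_gt0 ?exprn_gt0.
suff P j : forall q, (forall i, 1 <= q 0 i /\ q 0 i + 2 ^+ j * (M / 2 ^+ n) <= 1 + M) ->
    good q (2 ^+ j * (M / 2 ^+ n)).
  have := P n (const_mx 1); rewrite mulrCA divff ?mulr1 ?expf_neq0//; apply.
  by move=> i; rewrite mxE.
elim: j => [|j IH] q qP.
  rewrite expr0 mul1r; apply: dP => //=.
    by rewrite sub0r normrN gtr0_norm.
  move=> i; rewrite /= in_itv/=; have := qP i; rewrite expr0 mul1r => -[? ?].
  by apply/andP; split; lra.
have j0 : 0 < 2 ^+ j * (M / 2 ^+ n) by rewrite mulr_gt0 ?exprn_gt0.
rewrite exprS -mulrA; apply: good_double => // a b a0 b0; apply: IH => i.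
rewrite !mxE; case: (I2P i) => -> /=.
  by have := qP 0; rewrite exprS -mulrA; move: a0 => /orP[] /eqP-> [? ?]; split; lra.
by have := qP 1; rewrite exprS -mulrA; move: b0 => /orP[] /eqP-> [? ?]; split; lra.
Unshelve. all: by end_near. Qed.

Lemma infinite_area :
  (\int[area]_(z in [set z : R * R | disk (xy z.1 z.2)]) (f (xy z.1 z.2))%:E = +oo)%E.
Proof.
have f0 z : pull disk z -> 0 <= f (xy z.1 z.2).
  by move=> Dz; rewrite (le_trans _ (fmu Dz))// mulr_ge0 ?ltW// mu0.
apply/eqyP => A A0.
(* With B = 128 A / c, a square of side 1 + B contributes c / 128 (1 + B)^2, which exceeds c / 128 B
   = A. *)
have M0 : 0 < 1 + 128 * A / c by rewrite ltr_wpDr// divr_ge0 ?ltW// mulr_gt0.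
apply: le_trans (goodset_le_integral f0 (good_square M0)).
set B := 128 * A / c in M0 *; have B0 : 0 <= B by rewrite divr_ge0 ?ltW// mulr_gt0.
have -> : A = c / 128 * B by rewrite /B; field; exact: lt0r_neq0.
rewrite lee_fin ler_pM2l ?divr_gt0//; nra.
Qed.

End infinite_area.
(** * Hopf differentials *)

Lemma det_mx22 (R : comNzRingType) (A : 'M[R]_2) : \det A = A 0 0 * A 1 1 - A 0 1 * A 1 0.
Proof.
rewrite (expand_det_row A 0) big_ord_recl big_ord1 /cofactor !det_mx11 !mxE.
rewrite expr0 expr1 mul1r mulN1r mulrN.
by congr (A _ _ * A _ _ - A _ _ * A _ _); apply/val_inj.
Qed.

Section hopf.
Context {R : realType}.
Local Open Scope complex_scope.
Implicit Types (p q : 'rV[R]_2) (k a : R) (h : 'rV[R]_2 -> 'rV[R]_2).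

Lemma hopfE h sigma p (P := pullback h sigma p) :
  hopf h sigma p = ((P 0 0 - P 1 1) / 4) +i* (- (P 0 1 + P 1 0) / 4).
Proof.
rewrite /hopf -/P.
have e1 : 1 / 2%:R = (2^-1 : R) +i* 0 by rewrite complex_half mul0r div1r.
have e2 : - 'i / 2%:R = 0 +i* (- 2^-1) :> R[i].
  by rewrite (_ : - 'i = 0 +i* (-1))// ?complex_half ?mul0r ?mulN1r//; simpc.
have S (F : 'I_2 -> R[i]) : \sum_i F i = F 0 + F 1.
  by rewrite big_ord_recl big_ord1; congr (_ + F _); apply/val_inj.
rewrite !mxE S !mxE !S !mxE/= e1 e2.
by simpc; congr (_ +i* _); field.
Qed.

Definition grad_cay1 h p : 'I_2 -> R := fun i => partial i (fun q => cay1 (h q) : R^o) p.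
Definition grad_cay2 h p : 'I_2 -> R := fun i => partial i (fun q => cay2 (h q) : R^o) p.

(** In the coordinates X + i Y = c the metric is dX^2 + dY^2. *)
Lemma pullback_cay h p i j : differentiable h p -> disk (h p) ->
  pullback h metric p i j = grad_cay1 h p i * grad_cay1 h p j + grad_cay2 h p i * grad_cay2 h p j.
Proof.
move=> dh Dh; have [[_ G1] [_ G2]] := cay_comp_gradient dh Dh.
by rewrite pullback_metric /grad_cay1 /grad_cay2 !G1 !G2 /rho; ring.
Qed.

Lemma pullback_row_mx (A B : 'rV[R]_2 -> 'rV[R]_2) (s1 s2 : 'rV[R]_2 -> 'M[R]_2) p :
  differentiable A p -> differentiable B p ->
  pullback (fun q => row_mx (A q) (B q)) (product_metric s1 s2) p =
  pullback A s1 p + pullback B s2 p.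
Proof.
move=> dA dB; rewrite /pullback jacobian_row_mx// /product_metric row_mxKl row_mxKr.
move: ('J A p) ('J B p) (s1 (A p)) (s2 (B p)) => a b c d.
by rewrite mul_row_block !mulmx0 addr0 add0r tr_row_mx mul_row_col.
Qed.

Section parametrization.
Variables (k : R) (h1 h2 : 'rV[R]_2 -> 'rV[R]_2).
Hypothesis k0 : 0 < 1 + 2 * k.
Hypotheses (s1 : smooth disk h1) (D1 : forall p, disk p -> disk (h1 p)).
Hypothesis h2E : forall p, disk p -> h2 p = dil k (h1 p).

(** The second projection has coordinates (lambda X, Y), so the graph carries (1 + lambda^2) dX^2 +
    2 dY^2. *)
Lemma pullback_graph p i j : disk p ->
  pullback (fun q => row_mx (h1 q) (h2 q)) (product_metric metric metric) p i j =
  (1 + (1 + 2 * k) ^+ 2) * (grad_cay1 h1 p i * grad_cay1 h1 p j) + 2 * (grad_cay2 h1 p i * grad_cay2 h1 p j).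
Proof.
move=> Dp; have d1 : differentiable h1 p := s1 [::] Dp.
have e q (Dq : disk q) : dil k (h1 q) = h2 q by rewrite h2E.
have d2 : differentiable h2 p.
  apply: near_eq_differentiable (eq_near_on open_disk e Dp) _.
  exact: differentiable_comp d1 (smooth_dil k0 [::] (D1 Dp)).
have Dh2 : disk (h2 p) by rewrite h2E//; exact/dil_disk/D1.
apply: etrans (congr1 (fun M : 'M[R]_2 => M i j) (pullback_row_mx metric metric d1 d2)) _.
rewrite [LHS]mxE.
apply: etrans (congr2 +%R (pullback_cay i j d1 (D1 Dp)) (pullback_cay i j d2 Dh2)) _.
have [[c1 _] [c2 _]] := cay_comp_gradient d1 (D1 Dp).
have w1E l : grad_cay1 h2 p l = (1 + 2 * k) * grad_cay1 h1 p l.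
  have e1 q : disk q -> (1 + 2 * k) * cay1 (h1 q) = cay1 (h2 q).
    by move=> Dq; rewrite h2E// cay1_dil//; exact: D1.
  rewrite /grad_cay1 /partial -(near_eq_derive _ (eq_near_on open_disk e1 Dp)).
  have [_ /(_ l)] := has_gradientM (has_gradient_cst (1 + 2 * k) p) (has_gradientW c1).
  by rewrite mul0r add0r.
have w2E l : grad_cay2 h2 p l = grad_cay2 h1 p l.
  have e1 q : disk q -> cay2 (h1 q) = cay2 (h2 q).
    by move=> Dq; rewrite h2E// cay2_dil//; exact: D1.
  by rewrite /grad_cay2 /partial -(near_eq_derive _ (eq_near_on open_disk e1 Dp)).
rewrite !w1E !w2E.
by move: (grad_cay1 h1 p i) (grad_cay1 h1 p j) (grad_cay2 h1 p i) (grad_cay2 h1 p j) => a b c d; ring.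
Qed.

End parametrization.

(** Rescaling X by 1 + 2 a equalizes the two coefficients of the graph metric; this is the displayed
    equation. *)
Lemma conformal_parametrization_dil k a : 0 < 1 + 2 * k -> 0 < 1 + 2 * a ->
  (1 + (1 + 2 * k) ^+ 2) * (1 + 2 * a) ^+ 2 = 2 ->
  conformal_parametrization metric metric (dil k) (dil a) (dil k \o dil a).
Proof.
move=> k0 a0 ka; have sa := smooth_dil a0.
have Da q : disk q -> disk (dil a q) by exact: dil_disk.
have E := jacobian_cay sa Da (fun q => @cay1_dil _ a q a0) (fun q => @cay2_dil _ a q a0).
split=> //.
- exact: dil_diffeomorphism.
- move=> p Dp; have [E1 E2] := E p Dp 0; have [E3 E4] := E p Dp 1.
  (* Taking determinants in c o h = L o c gives [rho (h p)] det J = (1 + 2 a) [rho p]. *)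
  rewrite det_mx22 -(pmulr_rgt0 _ (rho_gt0 (Da _ Dp))).
  have := mulr_gt0 a0 (rho_gt0 Dp).
  rewrite [X in 0 < X -> _](_ : _ = (1 + 2 * a) * pair2 (dcay1 p) (- dcay2 p) 0 *
     pair2 (dcay2 p) (dcay1 p) 1 - pair2 (dcay2 p) (dcay1 p) 0 *
     ((1 + 2 * a) * pair2 (dcay1 p) (- dcay2 p) 1)); last by rewrite /rho /pair2/=; ring.
  rewrite -E1 -E2 -E3 -E4 => H; apply: (lt_le_trans H).
  by rewrite le_eqVlt; apply/orP; left; apply/eqP; rewrite /rho; ring.
- move=> p Dp; exists (2 * rho p); first by rewrite mulr_gt0// rho_gt0.
  have w1E l : grad_cay1 (dil a) p l = (1 + 2 * a) * pair2 (dcay1 p) (- dcay2 p) l.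
    have [[_ G1] _] := cay_comp_gradient (sa [::] _ Dp) (Da _ Dp).
    by rewrite /grad_cay1 G1; have [-> _] := E p Dp l.
  have w2E l : grad_cay2 (dil a) p l = pair2 (dcay2 p) (dcay1 p) l.
    have [_ [_ G2]] := cay_comp_gradient (sa [::] _ Dp) (Da _ Dp).
    by rewrite /grad_cay2 G2; have [_ ->] := E p Dp l.
  apply/matrixP => i j; rewrite (pullback_graph k0 sa Da)// !w1E !w2E !mxE /rho.
  have -> x y : (1 + (1 + 2 * k) ^+ 2) * ((1 + 2 * a) * x * ((1 + 2 * a) * y)) =
      ((1 + (1 + 2 * k) ^+ 2) * (1 + 2 * a) ^+ 2) * (x * y) by ring.
  rewrite ka; case: (I2P i) => ->; case: (I2P j) => ->;
    rewrite /pair2/= ?mulr1n ?mulr0n; ring.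
Qed.

Lemma hopf_dil_differential k a : 0 < 1 + 2 * k -> 0 < 1 + 2 * a ->
  (1 + (1 + 2 * k) ^+ 2) * (1 + 2 * a) ^+ 2 = 2 ->
  exists phi, hopf_differential metric metric (dil k) phi.
Proof.
move=> k0 a0 ka; exists (hopf (dil a) metric), (dil a), (dil k \o dil a).
by split=> //; exact: conformal_parametrization_dil.
Qed.

(** Here [h] is the first projection of an arbitrary parametrization. The last clause is
    conformality; together with the formula for [phi] it is all that the integrability arguments
    need to know about the gradients. *)
Lemma hopf_differential_dil k phi : 0 < 1 + 2 * k ->
  hopf_differential metric metric (dil k) phi ->
  exists h, [/\ diffeomorphism disk disk h,
    forall p, disk p -> phi p =
      ((grad_cay1 h p 0 ^+ 2 + grad_cay2 h p 0 ^+ 2 - (grad_cay1 h p 1 ^+ 2 + grad_cay2 h p 1 ^+ 2)) / 4) +i*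
      (- (grad_cay1 h p 0 * grad_cay1 h p 1 + grad_cay2 h p 0 * grad_cay2 h p 1) / 2) &
    forall p, disk p -> exists2 l : R, 0 < l &
      forall i j, (1 + (1 + 2 * k) ^+ 2) * (grad_cay1 h p i * grad_cay1 h p j) +
        2 * (grad_cay2 h p i * grad_cay2 h p j) = l *+ (i == j)].
Proof.
move=> k0 [h1 [h2 [[dh h2E _ cf] phiE]]]; exists h1; split => //.
- case: (dh) => s1 [_ [_ D1 _ _ _]] p Dp.
  have D1p : disk (h1 p) by apply: D1; exists p.
  rewrite phiE// hopfE; have P i j := pullback_cay i j (s1 [::] _ Dp) D1p; rewrite !P.
  move: (grad_cay1 h1 p 0) (grad_cay1 h1 p 1) (grad_cay2 h1 p 0) (grad_cay2 h1 p 1) => a b c d.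
  by congr (_ +i* _); field.
- case: (dh) => s1 [_ [_ D1 _ _ _]] p Dp.
  have {}D1 q : disk q -> disk (h1 q) by move=> Dq; apply: D1; exists q.
  have [l l0 lE] := cf p Dp; exists l => // i j.
  by rewrite -(pullback_graph k0 s1 D1 h2E)// lE mxE.
Qed.

(** For lambda = 1 both coefficients of the graph metric are 2, so conformality states that the real
    and imaginary parts of [phi] vanish. *)
Lemma hopf_differential_id phi : hopf_differential metric metric (dil 0) phi ->
  forall p : 'rV[R]_2, disk p -> phi p = 0.
Proof.
have z : 0 < 1 + 2 * 0 :> R by rewrite mulr0 addr0.
move=> /(hopf_differential_dil z)[h [_ phiE cf]] p Dp.
have [l _ lE] := cf p Dp; rewrite phiE//.
have := lE 0 0; have := lE 1 1; have := lE 0 1.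
rewrite !eqxx eqI2 mulr1n mulr0n mulr0 addr0 expr1n.
move: (grad_cay1 h p 0) (grad_cay1 h p 1) (grad_cay2 h p 0) (grad_cay2 h p 1) => a b c d e01 e11 e00.
by apply/eqP; rewrite eq_complex/=; apply/andP; split; apply/eqP; lra.
Qed.

End hopf.

(** * Non-integrability for lambda = 7 *)

Section not_integrable.
Context {R : realType}.
Local Open Scope complex_scope.
Implicit Types (p q : 'rV[R]_2) (h : 'rV[R]_2 -> 'rV[R]_2).

Lemma grad_cay_differentiable h p i : smooth disk h -> (forall q, disk q -> disk (h q)) ->
  disk p -> differentiable (fun q => grad_cay1 h q i : R^o) p /\
            differentiable (fun q => grad_cay2 h q i : R^o) p.
Proof.
move=> sh Dh Dp; have dh q : disk q -> differentiable h q by exact: (sh [::]).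
have [[a _] [b _]] := dcay_comp_gradient (dh _ Dp) (Dh _ Dp).
have J k : differentiable (fun q => 'J h q i k : R^o) p.
  have e q : disk q -> partial i h q 0 k = 'J h q i k.
    by move=> Dq; rewrite -jacobian_partial ?mxE//; exact: dh.
  apply: near_eq_differentiable (eq_near_on open_disk e Dp) _.
  by have /differentiable_mxP := sh [:: i] _ Dp; exact.
split.
- apply: (near_eq_differentiable
    (f := fun q => 'J h q i 0 * dcay1 (h q) - 'J h q i 1 * dcay2 (h q))).
    apply: eq_near_on Dp; first exact: open_disk.
    by move=> q Dq; rewrite /grad_cay1; have [[_ ->] _] := cay_comp_gradient (dh _ Dq) (Dh _ Dq).
  exact: (differentiableB (differentiableM (J 0) a) (differentiableM (J 1) b)).
- apply: (near_eq_differentiable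
    (f := fun q => 'J h q i 0 * dcay2 (h q) + 'J h q i 1 * dcay1 (h q))).
    apply: eq_near_on Dp; first exact: open_disk.
    by move=> q Dq; rewrite /grad_cay2; have [_ [_ ->]] := cay_comp_gradient (dh _ Dq) (Dh _ Dq).
  exact: (differentiableD (differentiableM (J 0) b) (differentiableM (J 1) a)).
Qed.

(* The inverse of p |-> (5 cay1 p, cay2 p).  The factor 5 makes this a conformal
   chart: the graph of dil 3 has metric 50 dX^2 + 2 dY^2. *)
Definition cay_inv q : 'rV[R]_2 :=
  let X := 5^-1 * q 0 0 + 1 in let E := X * X + q 0 1 * q 0 1 in
  xy (1 - 2 * X * E^-1) (2 * q 0 1 * E^-1).

(** The formula is z = 1 - 2 / l with l = c + 1: the local [X] is Re l and [E] is |l|^2, nonzero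
    because Re l > 1. *)
Lemma cay_invP q : 0 < q 0 0 -> [/\ disk (cay_inv q), 5 * cay1 (cay_inv q) = q 0 0,
  cay2 (cay_inv q) = q 0 1 & {for q, continuous cay_inv}].
Proof.
move=> q0; set X := 5^-1 * q 0 0 + 1; set E := X * X + q 0 1 * q 0 1.
have X1 : 1 < X by rewrite /X; lra.
have E0 : 0 < E by rewrite /E ltr_pwDl ?mulr_gt0 -?expr2 ?sqr_ge0 ?(lt_trans _ X1).
have EN := lt0r_neq0 E0.
have x0 : cay_inv q 0 0 = 1 - 2 * X * E^-1 by rewrite mxE.
have x1 : cay_inv q 0 1 = 2 * q 0 1 * E^-1 by rewrite mxE.
have dE : den (cay_inv q) = 4 * E^-1.
  by rewrite /den x0 x1; move: EN; rewrite /E => EN; field.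
have nE : defect (cay_inv q) = 4 * (X - 1) * E^-1.
  by rewrite /defect x0 x1; move: EN; rewrite /E => EN; field.
split.
- have : 0 < defect (cay_inv q).
    by rewrite nE !mulr_gt0 ?invr_gt0 ?subr_gt0.
  by rewrite /defect /disk/=; lra.
- rewrite /cay1 dE nE [X in _ = X](_ : _ = 5 * (X - 1)); last by rewrite /X; field.
  by field.
- by rewrite /cay2 dE x1; field.
apply: differentiable_continuous; apply/differentiable_mxP => i j; rewrite ord1.
have Gy := has_gradient_coord 1 q.
have GX := has_gradientD (has_gradientM (has_gradient_cst 5^-1 q) (has_gradient_coord 0 q))
  (has_gradient_cst 1 q).
have GV := has_gradientV (has_gradientD (has_gradientM GX GX) (has_gradientM Gy Gy)) EN.
have [d0 _] := has_gradientB (has_gradient_cst 1 q)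
  (has_gradientM (has_gradientM (has_gradient_cst 2 q) GX) GV).
have [d1 _] := has_gradientM (has_gradientM (has_gradient_cst 2 q) Gy) GV.
case: (I2P j) => ->.
- by apply: near_eq_differentiable d0; near=> y; rewrite /cay_inv mxE.
- by apply: near_eq_differentiable d1; near=> y; rewrite /cay_inv mxE.
Unshelve. all: by end_near. Qed.

(* The rows of [[5 a, b], [5 c, d]] are orthogonal of squared norm m, hence so
   are its columns. *)
Lemma hopf_norm_identity (a b c d m : R) : m != 0 ->
  25 * a ^+ 2 + b ^+ 2 = m -> 25 * c ^+ 2 + d ^+ 2 = m -> 25 * (a * c) + b * d = 0 ->
  Normc.normc (((a ^+ 2 + b ^+ 2 - (c ^+ 2 + d ^+ 2)) / 4) +i*
    (- (a * c + b * d) / 2)) = `|6 / 25 * m|.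
Proof.
move=> m0 e1 e2 e3; have bd : b ^+ 2 + d ^+ 2 = m.
  (* Multiplied by m, the claim becomes (b d)^2 = (25 a c)^2, the square of the orthogonality
     relation. *)
  apply: (mulfI m0); apply/eqP; rewrite -subr_eq0; apply/eqP.
  transitivity ((b * d) ^+ 2 - (m - b ^+ 2) * (m - d ^+ 2)); first by ring.
  rewrite -{1}e1 -{1}e2 !addrK.
  have -> : b * d = - (25 * (a * c)) by apply/eqP; rewrite -addr_eq0 addrC e3.
  by ring.
rewrite /Normc.normc -sqrtr_sqr; congr Num.sqrt.
have ea : a ^+ 2 = (m - b ^+ 2) / 25 by rewrite -e1; field.
have ec : c ^+ 2 = (m - d ^+ 2) / 25 by rewrite -e2; field.
have eac : a * c = - (b * d) / 25.
  have -> : b * d = - (25 * (a * c)) by apply/eqP; rewrite -addr_eq0 addrC e3.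
  by field.
by rewrite ea ec eac -bd; field.
Qed.

Lemma hopf_differential_not_in_L1 (phi : 'rV[R]_2 -> R[i]) :
  hopf_differential metric metric (dil 3) phi -> ~ in_L1 phi.
Proof.
have k0 : 0 < 1 + 2 * 3 :> R by lra.
move=> /(hopf_differential_dil k0)[h [dh phiE cf]].
have [sh [g [sg hD gD gh hg]]] := dh.
have Dh q : disk q -> disk (h q) by move=> Dq; apply: hD; exists q.
have Dg q : disk q -> disk (g q) by move=> Dq; apply: gD; exists q.
pose mu q := 25 * (grad_cay1 h q 0) ^+ 2 + (grad_cay2 h q 0) ^+ 2.
pose v q : 'rV[R]_2 := xy (5 * cay1 (h q)) (cay2 (h q)).
have muP p : disk p -> [/\ 0 < mu p, 25 * (grad_cay1 h p 0) ^+ 2 + (grad_cay2 h p 0) ^+ 2 = mu p,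
    25 * (grad_cay1 h p 1) ^+ 2 + (grad_cay2 h p 1) ^+ 2 = mu p
    & 25 * (grad_cay1 h p 0 * grad_cay1 h p 1) + grad_cay2 h p 0 * grad_cay2 h p 1 = 0].
  move=> Dp; have [l l0 lE] := cf p Dp.
  have := lE 0 0; have := lE 1 1; have := lE 0 1.
  rewrite !eqxx eqI2 mulr1n mulr0n /mu.
  by move: (grad_cay1 h p 0) (grad_cay1 h p 1) (grad_cay2 h p 0) (grad_cay2 h p 1) => a b c d e01 e11 e00; split; lra.
have vG p j : disk p -> has_gradient (fun q => v q 0 j) p
    (fun i => if j == 0 then 5 * grad_cay1 h p i else grad_cay2 h p i).
  move=> Dp; have dhp : differentiable h p := sh [::] _ Dp.
  have [[c1 _] [c2 _]] := cay_comp_gradient dhp (Dh _ Dp).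
  have G := has_gradientM (has_gradient_cst 5 p) (has_gradientW c1).
  case: (I2P j) => ->.
    apply: near_eq_has_gradient (has_gradient_eq G _).
      by near=> q; rewrite /v mxE.
    by move=> i; rewrite mul0r add0r.
  apply: near_eq_has_gradient (has_gradientW c2).
  by near=> q; rewrite /v mxE.
have muC p : disk p -> {for p, continuous mu}.
  move=> Dp; have [d1 d2] := grad_cay_differentiable 0 sh Dh Dp.
  apply: (@differentiable_continuous _ _ R^o).
  apply: (near_eq_differentiable (f := fun q =>
      25 * (grad_cay1 h q 0 * grad_cay1 h q 0) + grad_cay2 h q 0 * grad_cay2 h q 0 : R^o)).
    by near=> q; rewrite /mu !expr2.
  exact: (differentiableD
    (differentiableM (differentiable_cst _ _) (differentiableM d1 d1)) (differentiableM d2 d2)).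
clearbody mu.
(* The constant 6 / 25 is (1 - 1 / 25) / 4: in the conformal coordinate (U, V) = (5 X, Y) the first
   factor has metric dU^2 / 25 + dV^2. *)
rewrite /in_L1 (@infinite_area R v (g \o cay_inv) mu (fun p => Normc.normc (phi p)) (6 / 25))//.
- by move=> p Dp; have [] := has_gradient_row (fun j => vG p j Dp).
- move=> p i j Dp; have [_ -> _] := has_gradient_row (fun j => vG p j Dp).
  have [_ m0 m1 _] := muP p Dp.
  have {m0 m1}m : 25 * (grad_cay1 h p i) ^+ 2 + (grad_cay2 h p i) ^+ 2 = mu p by case: (I2P i) => ->.
  rewrite -m; have := sqr_ge0 (grad_cay1 h p i); have := sqr_ge0 (grad_cay2 h p i).
  by move: (grad_cay1 h p i) (grad_cay2 h p i) => a b; case: ifP => _; lra.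
- by move=> p /muP[].
- move=> p Dp; have [m0 e0 e1 e2] := muP p Dp.
  rewrite (phiE p Dp) (hopf_norm_identity (lt0r_neq0 m0) e0 e1 e2).
  exact: ler_norm.
- move=> q q0; have [Di e1 e2 ci] := cay_invP q0; split=> /=.
  + exact: Dg.
  + rewrite /v hg//; apply/rowP => i; rewrite mxE; case: (I2P i) => -> /=; [exact: e1|exact: e2].
  + apply: continuous_comp ci _; exact: differentiable_continuous (sg [::] _ Di).
Unshelve. all: by end_near. Qed.

End not_integrable.

Theorem mainTheorem2 (R : realType) :
  exists (g : 'rV[R]_2 -> 'M[R]_2) (f1 f2 psi : 'rV[R]_2 -> 'rV[R]_2),
    (riemannian_metric disk g /\ flat disk g) /\
    (minimal_diffeomorphism g g f1 /\ minimal_diffeomorphism g g f2) /\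
    (quasiconformal disk disk f1 /\ quasiconformal disk disk f2) /\
    (homeomorphism circle circle psi /\
       extends_to f1 psi /\ extends_to f2 psi) /\
    ((exists phi, hopf_differential g g f1 phi) /\
       forall phi, hopf_differential g g f1 phi -> in_L1 phi) /\
    ((exists phi, hopf_differential g g f2 phi) /\
       forall phi, hopf_differential g g f2 phi -> ~ in_L1 phi).
Proof.
have k0 : 0 < 1 + 2 * 0 :> R by lra.
have k3 : 0 < 1 + 2 * 3 :> R by lra.
(* As lambda = 1 + 2 k, the parameters 0 and 3 give lambda = 1 and lambda = 7. *)
exists metric, (dil 0), (dil 3), id; split.
  by split; [exact: riemannian_metric_metric | exact: flat_metric].
split; first by split; exact: dil_minimal.
split; first by split; exact: dil_quasiconformal.
split; first by split; [exact: homeomorphism_id | split; exact: dil_extends_to_id].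
split; split.
- by apply: (@hopf_dil_differential R 0 0) => //; ring.
- move=> phi /hopf_differential_id phi0; rewrite /in_L1.
  rewrite integral0_eq ?ltry// => z Dz; rewrite phi0//.
  by rewrite /Normc.normc/= expr0n/= addr0 sqrtr0.
(* 1 + 2 a = 1 / 5 solves (1 + 7^2) (1 + 2 a)^2 = 2. *)
- by apply: (@hopf_dil_differential R 3 (-2 / 5)) => //; [lra | field].
- exact: hopf_differential_not_in_L1.
Qed.
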